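(* Let $\mathcal{D},\mathcal{B}:\mathcal{C}_\Lambda\to\mathrm{Cat}$ be functors and let $U:\mathcal{D}\to\mathcal{B}$, with left adjoint $F:\mathcal{B}\to\mathcal{D}$, be a (functorial) monadic adjunction with unit $\eta:\mathrm{id}\to UF=\top$ and co-unit $\varepsilon:\bot=FU\to\mathrm{id}$, such that $\mathcal{B}$ has uniformly trivial deformation theory. Let $D\in\mathrm{Ob}\,\mathcal{D}(k)$ and let $B$ be any lift of $UD$ to $\mathcal{B}(\Lambda)$. Let $E^\bullet$ be the simplicial deformation complex with $$E^n=\mathrm{Hom}_{\mathcal{B}}(\top^nB,B)_{U(\varepsilon_D\circ\varepsilon_{\bot D}\circ\cdots\circ\varepsilon_{\bot^{n-1}D})},$$ product $g*h=g\circ\top^nh$ for $g\in E^n$, and operations, for $g\in E^n$, $$\partial^i(g)=g\circ\top^{i-1}U\varepsilon_{F\top^{n-i}B}\ (1\le i\le n),\qquad \sigma^i(g)=g\circ\top^i\eta_{\top^{n-i-1}B}\ (0\le i<n).$$ Then there is an equivalence of functors of groupoids $$\mathfrak{Def}_{\mathcal{D},D}\xrightarrow{\ \sim\ }\mathfrak{Def}_E.$$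
   Context: $\Lambda$ is a complete Noetherian local ring with maximal ideal $\mu$ and residue field $k$; $\mathcal{C}_\Lambda$ is the category of Artinian local $\Lambda$-algebras with residue field $k$. For a functor $\mathcal{B}$ on $\mathcal{C}_\Lambda$, $\mathcal{B}(\Lambda)$ means $\varprojlim_n\mathcal{B}(\Lambda/\mu^{n+1})$; $B\in\mathcal{B}(\Lambda)$ has an image $B(A)\in\mathcal{B}(A)$ for each $A\in\mathcal{C}_\Lambda$. The $\mathrm{Cat}$-valued functors are not required to take $k$ to a point. The sign ''$=$'' denotes canonical isomorphism. A Set-valued functor $F$ is smooth if $F(B)\to F(A)$ is surjective for every surjection $B\to A$ in $\mathcal{C}_\Lambda$; homogeneous if $F(B\times_AC)\to F(B)\times_{F(A)}F(C)$ is bijective for every surjection $B\to A$ and every $C\to A$. $\mathcal{B}:\mathcal{C}_\Lambda\to\mathrm{Cat}$ has uniformly trivial deformation theory if the functor $\mathrm{Mor}\,\mathcal{B}$ is smooth and homogeneous, and the functor of isomorphism classes of objects of $\mathcal{B}$ is constant, i.e. for every surjection $A\to A'$ in $\mathcal{C}_\Lambda$, $\mathcal{B}(A)\to\mathcal{B}(A')$ is full and essentially surjective. The adjunction is monadic if the comparison functor $\mathcal{D}\to\mathcal{B}^\top$ to $\top$-algebras, $D\mapsto(U\varepsilon_D:UFUD\to UD)$, is an equivalence. $\mathfrak{Def}_{\mathcal{D},D}(A)$ is the fibre of $\mathcal{D}(A)\to\mathcal{D}(k)$ over $(D,\mathrm{id})$: objects are those over $D$, morphisms those over $\mathrm{id}_D$.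 $\mathrm{Hom}_{\mathcal{B}}(\top^nB,B)_{\beta}$ is the functor on $\mathcal{C}_\Lambda$ sending $A$ to the fibre of $\mathrm{Hom}_{\mathcal{B}(A)}(\top^nB(A),B(A))\to\mathrm{Hom}_{\mathcal{B}(k)}(\top^nB(k),B(k))$ over $\beta$. A simplicial deformation complex (SDC) $E^\bullet$ consists of smooth homogeneous functors $E^n:\mathcal{C}_\Lambda\to\mathrm{Set}$, $n\ge0$, with $E^n(k)$ a point, maps $\partial^i:E^n\to E^{n+1}$ ($1\le i\le n$), $\sigma^i:E^n\to E^{n-1}$ ($0\le i<n$), and an associative product $*:E^m\times E^n\to E^{m+n}$ with identity $1\in E^0$, such that: $\partial^j\partial^i=\partial^i\partial^{j-1}$ for $i<j$; $\sigma^j\sigma^i=\sigma^i\sigma^{j+1}$ for $i\le j$; $\sigma^j\partial^i$ equals $\partial^i\sigma^{j-1}$ if $i<j$, $\mathrm{id}$ if $i=j,j+1$, $\partial^{i-1}\sigma^j$ if $i>j+1$; $\partial^i(e)*f=\partial^i(e*f)$; $e*\partial^i(f)=\partial^{i+m}(e*f)$; $\sigma^i(e)*f=\sigma^i(e*f)$; $e*\sigma^i(f)=\sigma^{i+m}(e*f)$, for $e\in E^m$. $E^0$ is then a group under $*$. $\mathrm{MC}_E(A)=\{\omega\in E^1(A):\omega*\omega=\partial^1(\omega)\}$, and $\mathfrak{Def}_E(A)$ is the groupoid with object set $\mathrm{MC}_E(A)$ and morphisms given by $E^0(A)$ acting by $\omega\mapsto g*\omega*g^{-1}$.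
   Formalization: The fibre defining Def_{𝒟,D}(A) is taken up to isomorphism: objects are those of 𝒟(A) with a given isomorphism of their image in 𝒟(k) with D, morphisms those compatible with it; with strict fibres the claim can fail. *)

(* Defs.v *)
From HB Require Import structures.
From mathcomp Require Import all_boot all_algebra.
From mathcomp Require Import boolp classical_sets.

Set Implicit Arguments.
Unset Strict Implicit.
Unset Printing Implicit Defensive.

Import GRing.Theory.
Local Open Scope ring_scope.
Local Open Scope classical_set_scope.
Local Open Scope quotient_scope.

Section Ideals.
Variable R : comNzRingType.
Implicit Types I J m : set R.

Definition is_ideal I : Prop :=
  [/\ I 0, forall x y, I x -> I y -> I (x + y) & forall a x, I x -> I (a * x)].

Definition ideal_gen (X : set R) : set R :=
  [set x | forall I, is_ideal I -> X `<=` I -> I x].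

Definition ideal_mul I J : set R :=
  ideal_gen [set z | exists x y, [/\ I x, J y & z = x * y]].

Definition ideal_pow I n : set R := iter n (ideal_mul I) [set: R].

Definition maximal_ideal m : Prop :=
  [/\ is_ideal m, ~ m 1 &
      forall I, is_ideal I -> ~ I 1 -> m `<=` I -> I `<=` m].

Definition local_ring m : Prop :=
  maximal_ideal m /\ forall m', maximal_ideal m' -> m' = m.

Definition noetherian : Prop :=
  forall I, is_ideal I -> exists s : seq R, I = ideal_gen [set x | x \in s].

Definition artinian : Prop :=
  forall I : nat -> set R, (forall n, is_ideal (I n)) ->
    (forall n, I n.+1 `<=` I n) ->
  exists N, forall n, (N <= n)%N -> I n = I N.

(* Bijectivity of R -> lim_n R / m^(n+1): existence of [x] is surjectivity,
   its uniqueness is injectivity. *)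
Definition adically_complete m : Prop :=
  forall u : nat -> R, (forall n, ideal_pow m n.+1 (u n.+1 - u n)) ->
  exists! x, forall n, ideal_pow m n.+1 (x - u n).

Lemma ideal_genP (X : set R) : is_ideal (ideal_gen X).
Proof.
split=> [I [] //|x y Xx Xy I hI XI|a x Xx I hI XI].
  by case: (hI) => _ + _; apply; [exact: Xx|exact: Xy].
by case: (hI) => _ _; apply; exact: Xx.
Qed.

Lemma ideal_powP I n : is_ideal (ideal_pow I n).
Proof. by case: n => [|n]; [split|exact: ideal_genP]. Qed.

Lemma ideal_oppr I x : is_ideal I -> I x -> I (- x).
Proof. by move=> [_ _ h] Ix; rewrite -mulN1r; apply: h. Qed.

Lemma ideal_subr I x y : is_ideal I -> I x -> I y -> I (x - y).
Proof. by move=> hI Ix Iy; case: (hI) => _ + _; apply=> //; apply: ideal_oppr. Qed.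

Lemma ideal_mulr I a x : is_ideal I -> I x -> I (x * a).
Proof. by move=> [_ _ h] Ix; rewrite mulrC; apply: h. Qed.

Lemma ideal_powS_sub I n : is_ideal I -> ideal_pow I n.+1 `<=` ideal_pow I n.
Proof.
move=> hI x; apply; first exact: ideal_powP.
by move=> _ [a [b [Ia Ib ->]]]; case: (ideal_powP I n) => _ _; apply.
Qed.

Lemma ideal_pow_sub I a b : is_ideal I -> (a <= b)%N ->
  ideal_pow I b `<=` ideal_pow I a.
Proof.
move=> hI /subnKC <-; elim: (b - a)%N => [|n IH]; first by rewrite addn0.
by rewrite addnS; apply: subset_trans IH; exact: ideal_powS_sub.
Qed.

Lemma ideal_pow_self I n : is_ideal I -> ideal_pow I n.+1 `<=` I.
Proof.
move=> hI x; apply=> // _ [a [b [Ia _ ->]]]; exact: ideal_mulr.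
Qed.

Lemma ideal_pow1 I : is_ideal I -> I `<=` ideal_pow I 1.
Proof. by move=> hI x Ix K hK; apply; exists x, 1; rewrite mulr1. Qed.

Lemma local_unit m x : local_ring m -> ~ m x -> exists y, x * y = 1.
Proof.
move=> [_ muniq] mx; apply/not_existsP => nx.
pose P (J : set R) := J = set0 \/ [/\ is_ideal J, J x & ~ J 1].
have [A [PA maxA]] : exists A, P A /\ forall B, A `<` B -> ~ P B.
  apply: Zorn_bigcup => F FP totF.
  have [[J0 [FJ0 J00]]|noF] := pselect (exists J, F J /\ J !=set0); last first.
    left; rewrite -subset0 => y [J FJ Jy].
    by apply: noF; exists J; split=> //; exists y.
  have FI J : F J -> J !=set0 -> [/\ is_ideal J, J x & ~ J 1].
    by move=> FJ [z Jz]; case: (FP _ FJ) => // J0'; rewrite J0' in Jz.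
  right; split.
  - split.
    + by exists J0 => //; case: (FI _ FJ0 J00) => -[].
    + move=> a b [J FJ Ja] [K FK Kb].
      have [[JI _ _] [KI _ _]] := (FI _ FJ (ex_intro _ a Ja), FI _ FK (ex_intro _ b Kb)).
      have [JK|KJ] := totF _ _ FJ FK.
        by exists K => //; case: KI => _ + _; apply=> //; exact: JK.
      by exists J => //; case: JI => _ + _; apply=> //; exact: KJ.
    + move=> c a [J FJ Ja]; exists J => //.
      by have [[_ _ h] _ _] := FI _ FJ (ex_intro _ a Ja); apply: h.
  - by exists J0 => //; case: (FI _ FJ0 J00).
  - by move=> [J FJ J1]; case: (FI _ FJ (ex_intro _ 1 J1)).
pose X : set R := [set z | exists y, z = x * y].
have XI : is_ideal X.
  split; first by exists 0; rewrite mulr0.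
    by move=> _ _ [a ->] [b ->]; exists (a + b); rewrite mulrDr.
  by move=> c _ [a ->]; exists (c * a); rewrite mulrCA.
have PX : P X.
  right; split=> //; first by exists 1; rewrite mulr1.
  by move=> [y xy]; apply: (nx y).
case: PA => [A0|[AI Ax A1]].
  apply: (maxA X) => //; rewrite A0; split=> [y []//|/(_ 0)].
  by apply; exists 0; rewrite mulr0.
have Am : A = m.
  apply: muniq; split=> // I II I1 AI'; apply: contrapT => nIA.
  by apply: (maxA I) => //; right; split=> //; apply: AI'.
by rewrite Am in Ax; apply: mx.
Qed.

Lemma local_intro m : is_ideal m -> ~ m 1 ->
  (forall x, ~ m x -> exists y, x * y = 1) -> local_ring m.
Proof.
move=> mI m1 mu.
have sub I : is_ideal I -> ~ I 1 -> I `<=` m.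
  move=> II I1 x Ix; apply: contrapT => /mu[y xy].
  by apply: I1; rewrite -xy; apply: ideal_mulr.
split=> [|m' [m'I m'1 m'max]]; first by split=> // I *; apply: sub.
by apply/seteqP; split; [apply: sub|apply: m'max => //; apply: sub].
Qed.

Definition dcc_above (K : set R) : Prop :=
  forall I : nat -> set R, (forall n, is_ideal (I n)) -> (forall n, K `<=` I n) ->
    (forall n, I n.+1 `<=` I n) ->
  exists N, forall n, (N <= n)%N -> I n = I N.

Lemma decr_sub (I : nat -> set R) a b : (forall n, I n.+1 `<=` I n) ->
  (a <= b)%N -> I b `<=` I a.
Proof.
move=> dI /subnKC <-; elim: (b - a)%N => [|n IH]; first by rewrite addn0.
by rewrite addnS; apply: subset_trans IH; exact: dI.
Qed.

Lemma dcc_above_sub K K' : K `<=` K' -> dcc_above K -> dcc_above K'.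
Proof. by move=> KK' h I II KI; apply: h => // n; apply: subset_trans (KI n). Qed.

Definition ideal_add1 K x : set R := [set z | exists a b, K a /\ z = a + b * x].

Lemma ideal_add1P K x : is_ideal K -> is_ideal (ideal_add1 K x).
Proof.
move=> [K0 KD KM]; split.
- by exists 0, 0; rewrite mul0r addr0.
- move=> _ _ [a [b [Ka ->]]] [c [d [Kc ->]]]; exists (a + c), (b + d).
  by split; [apply: KD|rewrite mulrDl addrACA].
- move=> c _ [a [b [Ka ->]]]; exists (c * a), (c * b).
  by split; [apply: KM|rewrite mulrDr mulrA].
Qed.

Lemma dcc_above_step m K x : local_ring m -> is_ideal K ->
  (forall a, m a -> K (a * x)) -> dcc_above (ideal_add1 K x) -> dcc_above K.
Proof.
move=> mloc KI Kx dccKx I II KIn dI.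
have [N hN] : exists N, forall n, (N <= n)%N -> ideal_add1 (I n) x = ideal_add1 (I N) x.
  apply: dccKx => [n|n|n].
  - exact: ideal_add1P.
  - by move=> _ [a [b [Ka ->]]]; exists a, b; split=> //; apply: KIn.
  - by move=> _ [a [b [Ka ->]]]; exists a, b; split=> //; apply: dI.
have [M hM] : exists M, forall n, (M <= n)%N -> I M x -> I n x.
  have [[M nIM]|allI] := pselect (exists M, ~ I M x); first by exists M.
  by exists 0%N => n _ _; apply: contrapT => nI; apply: allI; exists n.
exists (maxn N M) => n; rewrite geq_max => /andP[Nn Mn].
apply/seteqP; split; first by apply: decr_sub => //; rewrite geq_max Nn.
move=> z Iz.
have [a [b [Ia zE]]] : ideal_add1 (I n) x z.
  rewrite hN //; exists z, 0; rewrite mul0r addr0; split=> //.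
  by apply: decr_sub Iz => //; exact: leq_maxl.
rewrite zE; case: (II n) => _ IDn IMn; apply: IDn => //.
have Ibx : I (maxn N M) (b * x).
  have -> : b * x = z - a by rewrite zE addrC addKr.
  apply: ideal_subr => //; apply: decr_sub Ia => //; by rewrite geq_max Nn.
have [mb|/(local_unit mloc)[c bc]] := pselect (m b); first exact/KIn/Kx.
apply/IMn/hM => //; apply: (decr_sub dI (leq_maxr N M)).
rewrite -[x]mul1r -bc mulrAC mulrC; case: (II (maxn N M)) => _ _; apply.
by [].
Qed.

Lemma dcc_above_pow m n : noetherian -> local_ring m -> dcc_above (ideal_pow m n).
Proof.
move=> noeth mloc; have [[mI _ _] _] := mloc.
elim: n => [|n IH].
  move=> I _ TI _; exists 0%N => n _; apply/seteqP.
  by split=> x _; apply: TI.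
have [s sE] := noeth _ (ideal_powP m n).
have smul x a : x \in s -> m a -> ideal_pow m n.+1 (a * x).
  move=> xs ma I II; apply; exists a, x; split=> //.
  suff : ideal_pow m n x by []. by rewrite sE => J JI; apply.
suff h (t : seq R) K : is_ideal K -> {subset t <= s} -> ideal_pow m n.+1 `<=` K ->
    dcc_above (ideal_gen (K `|` [set x | x \in t])) -> dcc_above K.
  apply: (h s) => //; first exact: ideal_powP.
  apply: dcc_above_sub IH; rewrite sE => x sx I II KsI.
  by apply: sx => // y ys; apply: KsI; right.
elim: t K => [|x t IHt] K KI ts nK dcc.
  by apply: dcc_above_sub dcc => y; apply=> // z [].
have tss : {subset t <= s} by move=> y yt; apply: ts; rewrite inE yt orbT.
apply: (dcc_above_step (m := m) (x := x)) => //.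
  by move=> a ma; apply: nK; apply: (smul x a _ ma); apply: ts; rewrite inE eqxx.
apply: IHt => //; first exact: ideal_add1P.
  move=> y /nK Ky; exists y, 0; by rewrite mul0r addr0.
apply: dcc_above_sub dcc => y Hy I II HI; apply: Hy => // z [Kz|].
  by apply: HI; left; exists z, 0; rewrite mul0r addr0.
rewrite /= inE => /orP[/eqP->|zt]; last by apply: HI; right.
by apply: HI; left; exists 0, 1; rewrite add0r mul1r; split=> //; case: KI.
Qed.

Lemma artinian_nilpotent m : artinian -> local_ring m ->
  exists n, ideal_pow m n `<=` [set 0].
Proof.
move=> art mloc; have [[mI m1 _] _] := mloc.
have [N hN] := art (ideal_pow m) (ideal_powP m) (fun n => @ideal_powS_sub m n mI).
exists N => z Jz; apply: contrapT => z0.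
set J := ideal_pow m N in hN Jz.
have JE : ideal_mul m J = J by apply: (hN N.+1).
pose P x := exists2 w, J w & x * w <> 0.
have step x : P x -> exists y, m y /\ P (x * y).
  move=> [w Jw xw]; apply: contrapT => ny; apply: xw.
  have : ideal_mul m J w by rewrite JE.
  move=> /(_ [set t | x * t = 0]); apply.
    split=> /=; first by rewrite mulr0.
      by move=> a b xa xb; rewrite mulrDr xa xb addr0.
    by move=> a b xb; rewrite mulrCA xb mulr0.
  move=> _ [a [b [ma Jb ->]]] /=; apply: contrapT => xab; apply: ny.
  by exists a; split=> //; exists b => //; rewrite -mulrA.
pose S := {x : R | P x}.
have P1 : P 1 by exists z => //; rewrite mul1r.
have hf (u : S) : {y : R | m y /\ P (sval u * y)} by apply: cid; apply: step; case: u.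
pose f (u : S) : S := exist P _ (svalP (hf u)).2.
pose u n := iter n f (exist P 1 P1).
have uS n : exists y, m y /\ sval (u n.+1) = sval (u n) * y.
  by exists (sval (hf (u n))); split=> //; exact: (svalP (hf (u n))).1.
pose I n : set R := [set t | exists c, t = sval (u n) * c].
have II n : is_ideal (I n).
  split; first by exists 0; rewrite mulr0.
    by move=> _ _ [a ->] [b ->]; exists (a + b); rewrite mulrDr.
  by move=> c _ [a ->]; exists (c * a); rewrite mulrCA.
have dI n : I n.+1 `<=` I n.
  by move=> _ [c ->]; have [y [_ ->]] := uS n; exists (y * c); rewrite mulrA.
have [M hM] := art I II dI.
have [y [my uy]] := uS M.
have : I M.+1 (sval (u M)) by rewrite (hM M.+1) //; exists 1; rewrite mulr1.
move=> [c]; rewrite uy => uE.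
have [|d dE] := @local_unit m (1 - y * c) mloc.
  move=> myc; apply: m1; rewrite -[1](subrK (y * c)).
  by case: (mI) => _ + _; apply=> //; apply: ideal_mulr.
have u0 : sval (u M) = 0.
  by rewrite -[sval _]mulr1 -dE mulrA mulrBr mulr1 mulrA -uE subrr mul0r.
by case: (svalP (u M)) => w _; rewrite u0 mul0r.
Qed.
End Ideals.

Record pideal (R : comNzRingType) := PIdeal {
  pideal_set :> R -> Prop;
  pidealP : is_ideal pideal_set;
  pideal_proper : ~ pideal_set 1 }.

Definition pideal_pred (R : comNzRingType) (J : pideal R) : {pred R} :=
  fun x => `[< J x >].

Lemma pideal_closed (R : comNzRingType) (J : pideal R) :
  idealr_closed (pideal_pred J).
Proof.
have [J0 JD JM] := pidealP J; split=> [||a u v]; rewrite !unfold_in.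
- exact/asboolP.
- by apply/asboolP; apply: pideal_proper.
- by move=> /asboolP Ju /asboolP Jv; apply/asboolP/JD => //; apply: JM.
Qed.

HB.instance Definition _ (R : comNzRingType) (J : pideal R) :=
  isIdealr.Build R (pideal_pred J) (pideal_closed J).

Definition quot_ring (R : comNzRingType) (J : pideal R) : comNzRingType :=
  {ideal_quot (pideal_pred J)}.

Section Quot.
Variables (R : comNzRingType) (J : pideal R).

Definition qproj : {rmorphism R -> quot_ring J} :=
  \pi_({ideal_quot (pideal_pred J)}).

Lemma qproj_surj (y : quot_ring J) : exists x, qproj x = y.
Proof. by exists (repr y); exact: reprK. Qed.

Lemma qproj_eq x y : qproj x = qproj y <-> J (x - y).
Proof.
split=> [/eqP|h]; first by rewrite -Quotient.idealrBE => /asboolP.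
by apply/eqP; rewrite -Quotient.idealrBE; apply/asboolP.
Qed.

Lemma qproj_eq0 x : qproj x = 0 <-> J x.
Proof. by rewrite -(rmorph0 qproj) qproj_eq subr0. Qed.

Variables (S : comNzRingType) (phi : {rmorphism R -> S}).
Hypothesis phiJ : forall x, J x -> phi x = 0.

Definition qlift_fun of (forall x, J x -> phi x = 0) :=
  fun y : quot_ring J => phi (repr y).

Local Notation lift := (qlift_fun phiJ).

Lemma qlift_proj x : lift (qproj x) = phi x.
Proof.
apply/eqP; rewrite -subr_eq0 -rmorphB; apply/eqP/phiJ.
by apply/qproj_eq; exact: reprK.
Qed.

Lemma qlift_zmod : zmod_morphism lift.
Proof.
move=> a b; have [x <-] := qproj_surj a; have [y <-] := qproj_surj b.
by rewrite -rmorphB !qlift_proj rmorphB.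
Qed.

Lemma qlift_monoid : monoid_morphism lift.
Proof.
split=> [|a b]; first by rewrite -(rmorph1 qproj) qlift_proj rmorph1.
have [x <-] := qproj_surj a; have [y <-] := qproj_surj b.
by rewrite -rmorphM !qlift_proj rmorphM.
Qed.

HB.instance Definition _ := GRing.isZmodMorphism.Build (quot_ring J) S lift qlift_zmod.
HB.instance Definition _ := GRing.isMonoidMorphism.Build (quot_ring J) S lift qlift_monoid.

Definition qlift : {rmorphism quot_ring J -> S} := lift.
End Quot.

Lemma rmorph_ext (R S : nzRingType) (f g : {rmorphism R -> S}) : f =1 g -> f = g.
Proof.
case: f g => [f [a b]] [g [c d]] /= /funext fg; case: g / fg c d => c d.
congr GRing.RMorphism.Pack; congr GRing.RMorphism.Class.
  by case: a c => [a] [c]; congr Algebra.isNmodMorphism.Axioms_; apply: Prop_irrelevance.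
by case: b d => [b] [d]; congr GRing.isMonoidMorphism.Axioms_; apply: Prop_irrelevance.
Qed.

Lemma preimage_ideal (R S : comNzRingType) (f : {rmorphism R -> S}) (I : set S) :
  is_ideal I -> is_ideal [set x | I (f x)].
Proof.
move=> [I0 ID IM]; split=> [|x y Ix Iy|a x Ix] /=; first by rewrite rmorph0.
  by rewrite rmorphD; apply: ID.
by rewrite rmorphM; apply: IM.
Qed.

Lemma zero_ideal (R : comNzRingType) : is_ideal [set 0 : R].
Proof.
split=> // [x y|a x] /= ->; last by rewrite mulr0.
by move=> ->; rewrite addr0.
Qed.

Record complete_noetherian_local_ring := CNLRing {
  cnl_ring :> comNzRingType;
  cnl_max : set cnl_ring;
  cnl_local : local_ring cnl_max;
  cnl_noetherian : noetherian cnl_ring;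
  cnl_complete : adically_complete cnl_max }.

Section CLambda.
Variable L : complete_noetherian_local_ring.
Local Notation mu := (@cnl_max L).

Lemma mu_ideal : is_ideal mu. Proof. by case: (cnl_local L) => -[]. Qed.
Lemma mu_proper : ~ mu 1. Proof. by case: (cnl_local L) => -[]. Qed.

Definition mu_pideal : pideal L := PIdeal mu_ideal mu_proper.

Definition residue_field : comNzRingType := quot_ring mu_pideal.

(* The residue field of [A] is identified with that of [L] by the unique
   [L]-algebra surjection [ares] onto [L / mu], whose kernel is the maximal
   ideal of [A]. *)
Record artalg := ArtAlg {
  acar :> comNzRingType;
  astr : {rmorphism L -> acar};
  ares : {rmorphism acar -> residue_field};
  ares_str : forall x, ares (astr x) = qproj mu_pideal x;
  alocal : local_ring [set a | ares a = 0];
  aartinian : artinian acar }.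

Record chom (A B : artalg) := CHom {
  chom_fun :> {rmorphism A -> B};
  chom_str : forall x, chom_fun (astr A x) = astr B x }.

Definition surjective (S T : Type) (f : S -> T) : Prop := forall y, exists x, f x = y.

Lemma chom_ext A B (f g : chom A B) : f =1 g -> f = g.
Proof.
case: f g => [f hf] [g hg] /= /rmorph_ext fg; case: g / fg hg => hg.
by congr CHom; exact: Prop_irrelevance.
Qed.

Definition chom_id A : chom A A :=
  @CHom A A (idfun : {rmorphism A -> A}) (fun=> erefl).

Lemma chom_comp_str A B C (g : chom B C) (f : chom A B) x :
  (g \o f) (astr A x) = astr C x.
Proof. by rewrite /= !chom_str. Qed.

Definition chom_comp A B C (g : chom B C) (f : chom A B) : chom A C :=
  @CHom A C (g \o f : {rmorphism A -> C}) (chom_comp_str g f).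

Section QuotObj.
Variables (J : pideal L) (n : nat).
Hypotheses (Jmu : J `<=` mu) (Jn : ideal_pow mu n `<=` J).

Lemma quot_res_subproof x : J x -> qproj mu_pideal x = 0.
Proof. by move=> Jx; apply/qproj_eq0/Jmu. Qed.

Definition quot_res : {rmorphism quot_ring J -> residue_field} :=
  qlift quot_res_subproof.

Lemma quot_res_str x : quot_res (qproj J x) = qproj mu_pideal x.
Proof. exact: qlift_proj. Qed.

Lemma quot_local : local_ring [set a | quot_res a = 0].
Proof.
apply: local_intro.
- exact: preimage_ideal (zero_ideal _).
- by move=> /eqP; rewrite (rmorph1 quot_res) oner_eq0.
- move=> a; have [x <-] := qproj_surj a; rewrite /mkset quot_res_str qproj_eq0 => mx.
  have [y xy] := local_unit (cnl_local L) mx.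
  by exists (qproj J y); rewrite -rmorphM xy rmorph1.
Qed.

Lemma quot_artinian : artinian (quot_ring J).
Proof.
move=> I II dI.
have [|||N hN] := @dcc_above_sub _ _ _ Jn
    (dcc_above_pow (n := n) (@cnl_noetherian L) (cnl_local L))
    (fun i => [set x | I i (qproj J x)]).
- by move=> i; exact: preimage_ideal.
- by move=> i x /qproj_eq0 /= ->; case: (II i).
- by move=> i x /=; apply: dI.
exists N => i Ni; apply/seteqP; split=> a; have [x <-] := qproj_surj a.
  by move=> Ix; have : [set x | I i (qproj J x)] x by []; rewrite hN.
by move=> Ix; have : [set x | I N (qproj J x)] x by []; rewrite -(hN i).
Qed.

Definition quot_obj : artalg :=
  @ArtAlg (quot_ring J) (qproj J) quot_res quot_res_str quot_local quot_artinian.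

Lemma quot_hom_uniq (A : artalg) (f g : chom quot_obj A) : f = g.
Proof.
apply: chom_ext => a; have [x <-] := qproj_surj a.
by rewrite (chom_str f) (chom_str g).
Qed.

Definition quot_hom (A : artalg) (h : forall x, J x -> astr A x = 0) : chom quot_obj A :=
  @CHom quot_obj A (qlift h) (qlift_proj h).
End QuotObj.

Lemma mu_pow1_sub : ideal_pow mu 1 `<=` mu_pideal.
Proof. exact: ideal_pow_self mu_ideal. Qed.

Definition kobj : artalg := @quot_obj mu_pideal 1 (@subset_refl _ mu) mu_pow1_sub.

Definition to_k (A : artalg) : chom A kobj := @CHom A kobj (ares A) (@ares_str A).

Lemma mu_pow_proper n : ~ ideal_pow mu n.+1 1.
Proof. by move=> /(ideal_pow_self mu_ideal); exact: mu_proper. Qed.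

Definition mu_pow_pideal n : pideal L := PIdeal (ideal_powP mu n.+1) (@mu_pow_proper n).

Definition trunc n : artalg :=
  @quot_obj (mu_pow_pideal n) n.+1 (@ideal_pow_self _ _ n mu_ideal) (@subset_refl _ _).

Lemma trunc_le_subproof m n : (m <= n)%N ->
  forall x, mu_pow_pideal n x -> astr (trunc m) x = 0.
Proof. by move=> mn x nx; apply/qproj_eq0; apply: ideal_pow_sub nx => //; exact: mu_ideal. Qed.

Definition trunc_hom m n (mn : (m <= n)%N) : chom (trunc n) (trunc m) :=
  quot_hom _ _ (trunc_le_subproof mn).

Lemma astr_pow (A : artalg) n x : ideal_pow mu n x ->
  ideal_pow [set a : A | ares A a = 0] n (astr A x).
Proof.
have [mI m1 _] := (alocal A).1.
elim: n x => [|n IH] x //= /(_ [set x | ideal_pow [set a : A | ares A a = 0] n.+1 (astr A x)]).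
apply.
  exact/preimage_ideal/ideal_powP.
move=> _ [a [b [ma Jb ->]]] I II; apply; exists (astr A a), (astr A b); split.
- by rewrite /= ares_str; apply/qproj_eq0.
- exact: IH.
- by rewrite rmorphM.
Qed.

Lemma artalg_killed (A : artalg) :
  exists n, forall x, mu_pow_pideal n x -> astr A x = 0.
Proof.
have [mI m1 _] := (alocal A).1.
have [n hn] := artinian_nilpotent (@aartinian A) (alocal A).
exists n => x /astr_pow nx; exact: (hn _ (ideal_powS_sub mI (nx A))).
Qed.

Definition level (A : artalg) : nat := sval (cid (artalg_killed A)).

Definition from_trunc (A : artalg) : chom (trunc (level A)) A :=
  quot_hom _ _ (svalP (cid (artalg_killed A))).
End CLambda.

Reserved Notation "g \oc f" (at level 50, left associativity).
Reserved Notation "g \oa f" (at level 50, left associativity).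

Record category := Category {
  ob :> Type;
  hom : ob -> ob -> Type;
  idm : forall x, hom x x;
  comp : forall x y z, hom y z -> hom x y -> hom x z;
  comp1m : forall x y (f : hom x y), comp (idm y) f = f;
  compm1 : forall x y (f : hom x y), comp f (idm x) = f;
  compA : forall x y z w (h : hom z w) (g : hom y z) (f : hom x y),
    comp h (comp g f) = comp (comp h g) f }.

Notation "g \oc f" := (comp g f).

Definition is_iso (C : category) (x y : C) (f : hom x y) : Prop :=
  exists g : hom y x, g \oc f = idm x /\ f \oc g = idm y.

Definition is_groupoid (C : category) : Prop :=
  forall (x y : C) (f : hom x y), is_iso f.

Record functor (C D : category) := Functor {
  fob :> C -> D;
  fmor : forall x y : C, hom x y -> hom (fob x) (fob y);
  fmor_id : forall x, fmor (idm x) = idm (fob x);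
  fmor_comp : forall x y z (g : hom y z) (f : hom x y),
    fmor (g \oc f) = fmor g \oc fmor f }.

Section FunctorComp.
Variables (C D E : category) (G : functor D E) (F : functor C D).

Lemma functor_comp_id x : fmor G (fmor F (idm x)) = idm (G (F x)).
Proof. by rewrite !fmor_id. Qed.

Lemma functor_comp_comp x y z (g : hom y z) (f : hom x y) :
  fmor G (fmor F (g \oc f)) = fmor G (fmor F g) \oc fmor G (fmor F f).
Proof. by rewrite !fmor_comp. Qed.

Definition functor_comp : functor C E :=
  @Functor C E (fun x => G (F x)) (fun x y f => fmor G (fmor F f))
    functor_comp_id functor_comp_comp.
End FunctorComp.

Definition full (C D : category) (F : functor C D) : Prop :=
  forall (x y : C) (g : hom (F x) (F y)), exists f : hom x y, fmor F f = g.

Definition faithful (C D : category) (F : functor C D) : Prop :=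
  forall (x y : C) (f g : hom x y), fmor F f = fmor F g -> f = g.

Definition essentially_surjective (C D : category) (F : functor C D) : Prop :=
  forall y : D, exists (x : C) (f : hom (F x) y), is_iso f.

Definition equivalence (C D : category) (F : functor C D) : Prop :=
  [/\ full F, faithful F & essentially_surjective F].

(* Arrows with their endpoints.  Equations between morphisms whose endpoints
   agree only up to a propositional equality (as happens with strict functors
   into Cat) are stated in [arr C]. *)
Record arr (C : category) := Arr { src : C; tgt : C; amor : hom src tgt }.

Definition amap (C D : category) (F : functor C D) (a : arr C) : arr D :=
  Arr (fmor F (amor a)).

(* The composite of [g] and [f] when [tgt f = src g]; the value is irrelevant
   otherwise. *)
Definition acomp (C : category) (g f : arr C) : arr C :=
  match pselect (tgt f = src g) with
  | left e => Arr (amor g \oc ecast y (hom (src f) y) e (amor f))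
  | right _ => f
  end.

Notation "g \oa f" := (acomp g f).

Section Arr.
Variable C : category.
Implicit Types a b c : arr C.

Lemma ArrE a : Arr (amor a) = a. Proof. by case: a. Qed.

Lemma Arr_inj (x y : C) (f g : hom x y) : Arr f = Arr g -> f = g.
Proof.
move=> e.
pose P (a : arr C) := exists (e1 : x = src a) (e2 : y = tgt a),
   ecast z (hom z (tgt a)) e1 (ecast z (hom x z) e2 f) = amor a.
have : P (Arr g) by rewrite -e; exists erefl, erefl.
by move=> [e1 [e2]]; rewrite /= (Prop_irrelevance e1 erefl) (Prop_irrelevance e2 erefl).
Qed.

Lemma acompE (x y z : C) (g : hom y z) (f : hom x y) : Arr g \oa Arr f = Arr (g \oc f).
Proof.
rewrite /acomp; case: pselect => //= e.
by rewrite (Prop_irrelevance e erefl).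
Qed.

Lemma arrP a (x y : C) : src a = x -> tgt a = y -> exists f : hom x y, a = Arr f.
Proof. by case: a => x' y' f /= <- <-; exists f. Qed.

Lemma src_acomp b a : tgt a = src b -> src (b \oa a) = src a.
Proof. by case: a b => x y f [y' z g] /= e; case: _ / e g => g; rewrite acompE. Qed.

Lemma tgt_acomp b a : tgt a = src b -> tgt (b \oa a) = tgt b.
Proof. by case: a b => x y f [y' z g] /= e; case: _ / e g => g; rewrite acompE. Qed.

Lemma acompA c b a : tgt a = src b -> tgt b = src c -> c \oa (b \oa a) = c \oa b \oa a.
Proof.
case: a b c => x y f [y' z g] [z' w h] /= e; case: _ / e g => g e'.
by case: _ / e' h => h; rewrite !acompE compA.
Qed.

Lemma acomp1a a y : tgt a = y -> Arr (idm y) \oa a = a.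
Proof. by case: a => x y' f /= <-; rewrite acompE comp1m. Qed.

Lemma acompa1 a x : src a = x -> a \oa Arr (idm x) = a.
Proof. by case: a => x' y f /= <-; rewrite acompE compm1. Qed.
End Arr.

Lemma amap_acomp (C D : category) (F : functor C D) (b a : arr C) :
  tgt a = src b -> amap F (b \oa a) = amap F b \oa amap F a.
Proof.
case: a b => x y f [y' z g] /= e; case: _ / e g => g.
by rewrite acompE /amap /= acompE fmor_comp.
Qed.

Lemma amap_functor_comp (C D E : category) (G : functor D E) (F : functor C D) a :
  amap (functor_comp G F) a = amap G (amap F a).
Proof. by []. Qed.

Record adjunction (C D : category) (U : functor D C) (F : functor C D) := Adjunction {
  adj_unit : forall x : C, hom x (U (F x));
  adj_counit : forall y : D, hom (F (U y)) y;
  unit_nat : forall (x x' : C) (f : hom x x'),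
    adj_unit x' \oc f = fmor U (fmor F f) \oc adj_unit x;
  counit_nat : forall (y y' : D) (f : hom y y'),
    adj_counit y' \oc fmor F (fmor U f) = f \oc adj_counit y;
  triangleF : forall x, adj_counit (F x) \oc fmor F (adj_unit x) = idm (F x);
  triangleU : forall y, fmor U (adj_counit y) \oc adj_unit (U y) = idm (U y) }.

Section EilenbergMoore.
Variables (C D : category) (U : functor D C) (F : functor C D).
Variable adj : adjunction U F.

Definition top : functor C C := functor_comp U F.
Definition bot : functor D D := functor_comp F U.
Definition mult (x : C) : hom (top (top x)) (top x) := fmor U (adj_counit adj (F x)).

Record algebra := Algebra {
  alg_ob : C;
  alg_act : hom (top alg_ob) alg_ob;
  alg_unit : alg_act \oc adj_unit adj alg_ob = idm alg_ob;
  alg_assoc : alg_act \oc fmor top alg_act = alg_act \oc mult alg_ob }.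

Definition alg_hom (X Y : algebra) : Type :=
  {f : hom (alg_ob X) (alg_ob Y) | f \oc alg_act X = alg_act Y \oc fmor top f}.

Lemma alg_hom_ext X Y (f g : alg_hom X Y) : sval f = sval g -> f = g.
Proof. by case: f g => [f hf] [g hg] /= fg; exact: eq_exist. Qed.

Lemma alg_id_subproof X :
  idm (alg_ob X) \oc alg_act X = alg_act X \oc fmor top (idm (alg_ob X)).
Proof. by rewrite fmor_id comp1m compm1. Qed.

Definition alg_id X : alg_hom X X := exist _ _ (alg_id_subproof X).

Lemma alg_comp_subproof X Y Z (g : alg_hom Y Z) (f : alg_hom X Y) :
  (sval g \oc sval f) \oc alg_act X = alg_act Z \oc fmor top (sval g \oc sval f).
Proof. by rewrite -compA (svalP f) compA (svalP g) -compA fmor_comp. Qed.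

Definition alg_comp X Y Z (g : alg_hom Y Z) (f : alg_hom X Y) : alg_hom X Z :=
  exist _ _ (alg_comp_subproof g f).

Lemma alg_comp1m X Y (f : alg_hom X Y) : alg_comp (alg_id Y) f = f.
Proof. by apply: alg_hom_ext; exact: comp1m. Qed.

Lemma alg_compm1 X Y (f : alg_hom X Y) : alg_comp f (alg_id X) = f.
Proof. by apply: alg_hom_ext; exact: compm1. Qed.

Lemma alg_compA X Y Z W (h : alg_hom Z W) (g : alg_hom Y Z) (f : alg_hom X Y) :
  alg_comp h (alg_comp g f) = alg_comp (alg_comp h g) f.
Proof. by apply: alg_hom_ext; exact: compA. Qed.

Definition eilenberg_moore : category :=
  Category alg_comp1m alg_compm1 alg_compA.

Lemma comparison_unit (y : D) : fmor U (adj_counit adj y) \oc adj_unit adj (U y) = idm (U y).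
Proof. exact: triangleU. Qed.

Lemma comparison_assoc (y : D) :
  fmor U (adj_counit adj y) \oc fmor top (fmor U (adj_counit adj y))
  = fmor U (adj_counit adj y) \oc mult (U y).
Proof. by rewrite /= /mult -!fmor_comp counit_nat. Qed.

Definition comparison_ob (y : D) : eilenberg_moore :=
  Algebra (comparison_unit y) (comparison_assoc y).

Lemma comparison_mor_subproof (y y' : D) (f : hom y y') :
  fmor U f \oc alg_act (comparison_ob y)
  = alg_act (comparison_ob y') \oc fmor top (fmor U f).
Proof. by rewrite /= -!fmor_comp counit_nat. Qed.

Definition comparison_mor (y y' : D) (f : hom y y') :
    hom (comparison_ob y) (comparison_ob y') :=
  exist _ _ (comparison_mor_subproof f).

Lemma comparison_id y : comparison_mor (idm y) = idm (comparison_ob y).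
Proof. by apply: alg_hom_ext; exact: fmor_id. Qed.

Lemma comparison_comp (x y z : D) (g : hom y z) (f : hom x y) :
  comparison_mor (g \oc f) = comparison_mor g \oc comparison_mor f.
Proof. by apply: alg_hom_ext; exact: fmor_comp. Qed.

Definition comparison : functor D eilenberg_moore :=
  Functor comparison_id comparison_comp.

Definition monadic : Prop := equivalence comparison.

(* eps_y o eps_(bot y) o ... o eps_(bot^(n-1) y) *)
Fixpoint counit_iter (y : D) (n : nat) : hom (iter n bot y) y :=
  if n is n'.+1 then counit_iter y n' \oc adj_counit adj (iter n' bot y) else idm y.

Lemma counit_anat (a : arr D) :
  Arr (adj_counit adj (tgt a)) \oa amap bot a = a \oa Arr (adj_counit adj (src a)).
Proof. by case: a => x y f; rewrite /amap /= !acompE counit_nat. Qed.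

Lemma unit_anat (a : arr C) :
  Arr (adj_unit adj (tgt a)) \oa a = amap top a \oa Arr (adj_unit adj (src a)).
Proof. by case: a => x y f; rewrite /amap /= !acompE unit_nat. Qed.

Lemma mult_anat (a : arr C) :
  Arr (mult (tgt a)) \oa amap top (amap top a) = amap top a \oa Arr (mult (src a)).
Proof. by case: a => x y f; rewrite /amap /= !acompE /mult -!fmor_comp counit_nat. Qed.
End EilenbergMoore.

Section IterFunctor.
Variables (C : category) (T : functor C C).

Lemma src_iter n (a : arr C) : src (iter n (amap T) a) = iter n T (src a).
Proof. by elim: n => //= n ->. Qed.

Lemma tgt_iter n (a : arr C) : tgt (iter n (amap T) a) = iter n T (tgt a).
Proof. by elim: n => //= n ->. Qed.

Lemma iter_acomp n (b a : arr C) : tgt a = src b ->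
  iter n (amap T) (b \oa a) = iter n (amap T) b \oa iter n (amap T) a.
Proof.
by move=> e; elim: n => //= n ->; rewrite amap_acomp // src_iter tgt_iter e.
Qed.

Lemma iter_idm n x : iter n (amap T) (Arr (idm x)) = Arr (idm (iter n T x)).
Proof. by elim: n => //= n ->; rewrite /amap /= fmor_id. Qed.
End IterFunctor.

Section FunctorsOnCLambda.
Variable L : complete_noetherian_local_ring.
Local Notation CL := (artalg L).
Local Notation k := (kobj L).

Record set_functor := SetFunctor {
  sobj :> CL -> Type;
  smap : forall A B, chom A B -> sobj A -> sobj B;
  smap_id : forall A x, smap (chom_id A) x = x;
  smap_comp : forall A B C (g : chom B C) (f : chom A B) x,
    smap (chom_comp g f) x = smap g (smap f x) }.

Arguments smap s [A B] f x : rename.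

Definition smooth (F : set_functor) : Prop :=
  forall (B A : CL) (f : chom B A), surjective f -> surjective (smap F f).

(* [P], with its projections, is the fibre product B x_A C of rings; this
   determines it up to a unique isomorphism of [artalg]. *)
Definition is_fibre_product (A B C P : CL) (f : chom B A) (g : chom C A)
    (p : chom P B) (q : chom P C) : Prop :=
  (forall x, f (p x) = g (q x)) /\
  (forall b c, f b = g c -> exists! x, p x = b /\ q x = c).

Definition homogeneous (F : set_functor) : Prop :=
  forall (A B C P : CL) (f : chom B A) (g : chom C A) (p : chom P B) (q : chom P C),
    surjective f -> is_fibre_product f g p q ->
  forall (u : F B) (v : F C), smap F f u = smap F g v ->
    exists! w : F P, smap F p w = u /\ smap F q w = v.

(* Strict functors to Cat; [cmap_id] and [cmap_comp], on identity arrows, give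
   the corresponding equalities of objects. *)
Record cat_functor := CatFunctor {
  cobj :> CL -> category;
  cmap : forall A B, chom A B -> functor (cobj A) (cobj B);
  cmap_id : forall A (a : arr (cobj A)), amap (cmap (chom_id A)) a = a;
  cmap_comp : forall A B C (g : chom B C) (f : chom A B) (a : arr (cobj A)),
    amap (cmap (chom_comp g f)) a = amap (cmap g) (amap (cmap f) a) }.

Definition Mor (X : cat_functor) : set_functor :=
  @SetFunctor (fun A => arr (X A)) (fun A B f => amap (cmap X f))
    (@cmap_id X) (@cmap_comp X).

Definition uniformly_trivial_deformation_theory (X : cat_functor) : Prop :=
  [/\ smooth (Mor X), homogeneous (Mor X) &
      forall (A A' : CL) (f : chom A A'), surjective f ->
        full (cmap X f) /\ essentially_surjective (cmap X f)].

Lemma cmap_comp_ob (X : cat_functor) A B C (g : chom B C) (f : chom A B) (x : X A) :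
  cmap X (chom_comp g f) x = cmap X g (cmap X f x).
Proof. exact: (congr1 (@src _) (cmap_comp g f (Arr (idm x)))). Qed.

Record cat_trans (X Y : cat_functor) := CatTrans {
  ctrans :> forall A, functor (X A) (Y A);
  ctrans_nat : forall A A' (f : chom A A') (a : arr (X A)),
    amap (ctrans A') (amap (cmap X f) a) = amap (cmap Y f) (amap (ctrans A) a) }.

Lemma ctrans_nat_ob (X Y : cat_functor) (U : cat_trans X Y) A A' (f : chom A A') (x : X A) :
  U A' (cmap X f x) = cmap Y f (U A x).
Proof. exact: (congr1 (@src _) (ctrans_nat U f (Arr (idm x)))). Qed.

Record functorial_adjunction (X Y : cat_functor) (U : cat_trans Y X) (F : cat_trans X Y) :=
  FunctorialAdjunction {
  fadj :> forall A, adjunction (U A) (F A);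
  unit_base : forall A A' (f : chom A A') (x : X A),
    amap (cmap X f) (Arr (adj_unit (fadj A) x)) = Arr (adj_unit (fadj A') (cmap X f x));
  counit_base : forall A A' (f : chom A A') (y : Y A),
    amap (cmap Y f) (Arr (adj_counit (fadj A) y)) = Arr (adj_counit (fadj A') (cmap Y f y)) }.

Record lim_ob (X : cat_functor) := LimOb {
  lim_term : forall n, X (trunc L n);
  lim_compat : forall n,
    cmap X (trunc_hom L (leqnSn n)) (lim_term n.+1) = lim_term n }.

(* The image in [X A] of an object of lim_n X(L / mu^(n+1)). *)
Definition lim_at (X : cat_functor) (b : lim_ob X) (A : CL) : X A :=
  cmap X (from_trunc A) (lim_term b (level A)).

Lemma lim_term_le (X : cat_functor) (b : lim_ob X) m n (h : chom (trunc L n) (trunc L m)) :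
  (m <= n)%N -> cmap X h (lim_term b n) = lim_term b m.
Proof.
move=> /subnKC; move: (n - m)%N => d e; case: _ / e h => {n}.
elim: d => [|d IH].
  rewrite addn0 => h; rewrite (quot_hom_uniq h (chom_id _)).
  exact: (congr1 (@src _) (cmap_id (Arr (idm (lim_term b m))))).
rewrite addnS => h.
have [g] : inhabited (chom (trunc L (m + d)) (trunc L m)).
  by split; exact: trunc_hom (leq_addr _ _).
rewrite (quot_hom_uniq h (chom_comp g (trunc_hom L (leqnSn (m + d))))).
by rewrite cmap_comp_ob lim_compat IH.
Qed.

Lemma lim_atE (X : cat_functor) (b : lim_ob X) n A (h : chom (trunc L n) A) :
  cmap X h (lim_term b n) = lim_at b A.
Proof.
rewrite /lim_at; move: (level A) (from_trunc A) => m g.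
wlog mn : m n g h / (m <= n)%N.
  by move=> H; case/orP: (leq_total m n) => le; [exact: H|exact: esym (H n m h g le)].
rewrite (quot_hom_uniq h (chom_comp g (trunc_hom L mn))).
by rewrite cmap_comp_ob lim_term_le.
Qed.

Lemma cmap_lim_at (X : cat_functor) (b : lim_ob X) A A' (f : chom A A') :
  cmap X f (lim_at b A) = lim_at b A'.
Proof. by rewrite -(lim_atE b (chom_comp f (from_trunc A))) cmap_comp_ob. Qed.

Lemma to_k_uniq (A : CL) (f : chom A k) : f = to_k A.
Proof.
have ker a : ares A a = 0 -> f a = 0.
  move=> ra; have [z hz] := qproj_surj (f a).
  have [mz|mz] := pselect (mu_pideal L z); first by rewrite -hz; apply/qproj_eq0.
  have /(local_unit (alocal A))[c dc] : ~ ares A (a - astr A z) = 0.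
    rewrite rmorphB ra sub0r ares_str => /eqP; rewrite oppr_eq0 => /eqP.
    by rewrite qproj_eq0.
  have : f (a - astr A z) * f c = 1 by rewrite -rmorphM dc rmorph1.
  rewrite rmorphB chom_str hz subrr mul0r => /esym/eqP.
  by rewrite oner_eq0.
apply: chom_ext => a; have [x hx] := qproj_surj (ares A a).
have -> : a = (a - astr A x) + astr A x by rewrite subrK.
rewrite rmorphD chom_str ker ?add0r /=.
  by rewrite rmorphD rmorphB ares_str hx subrr add0r.
by rewrite rmorphB ares_str hx subrr.
Qed.

Lemma amap_to_k (X : cat_functor) A A' (f : chom A A') (a : arr (X A)) :
  amap (cmap X (to_k A')) (amap (cmap X f) a) = amap (cmap X (to_k A)) a.
Proof. by rewrite -cmap_comp (to_k_uniq (chom_comp _ _)). Qed.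

Lemma ob_to_k (X : cat_functor) A A' (f : chom A A') (x : X A) :
  cmap X (to_k A') (cmap X f x) = cmap X (to_k A) x.
Proof. by rewrite -cmap_comp_ob (to_k_uniq (chom_comp _ _)). Qed.

Record pseudo_trans (X Y : cat_functor) := PseudoTrans {
  ptrans :> forall A, functor (X A) (Y A);
  pcomm : forall A A' (f : chom A A') (x : X A),
    hom (cmap Y f (ptrans A x)) (ptrans A' (cmap X f x));
  pcomm_iso : forall A A' (f : chom A A') (x : X A), is_iso (pcomm f x);
  pcomm_nat : forall A A' (f : chom A A') (x y : X A) (h : hom x y),
    pcomm f y \oc fmor (cmap Y f) (fmor (ptrans A) h)
    = fmor (ptrans A') (fmor (cmap X f) h) \oc pcomm f x;
  pcomm_id : forall A (x : X A), Arr (pcomm (chom_id A) x) = Arr (idm (ptrans A x));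
  pcomm_comp : forall A B C (g : chom B C) (f : chom A B) (x : X A),
    Arr (pcomm (chom_comp g f) x)
    = Arr (pcomm g (cmap X f x)) \oa amap (cmap Y g) (Arr (pcomm f x)) }.

Definition groupoid_functors_equivalent (X Y : cat_functor) : Prop :=
  [/\ forall A, is_groupoid (X A), forall A, is_groupoid (Y A) &
      exists t : pseudo_trans X Y, forall A, equivalence (t A)].

Section Def.
Variables (X : cat_functor) (D : X k).

(* The fibre of X(A) -> X(k) over (D, id) is the homotopy fibre: an object is an
   object of X(A) with an isomorphism [dphi] from its image in X(k) to [D], and a
   morphism is one that these isomorphisms carry to the identity of [D].  For
   strict fibres the functor would not be invariant under equivalences of [X].
   [dphi] is an arrow because its source changes, by a propositional equality,
   when the object is pushed forward. *)
Record def_ob (A : CL) := DefOb {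
  dob : X A;
  dphi : arr (X k);
  dphi_src : src dphi = cmap X (to_k A) dob;
  dphi_tgt : tgt dphi = D;
  dphi_iso : is_iso (amor dphi) }.

Definition def_hom A (x y : def_ob A) : Type :=
  {f : hom (dob x) (dob y) | dphi y \oa amap (cmap X (to_k A)) (Arr f) = dphi x}.

Lemma def_hom_ext A (x y : def_ob A) (f g : def_hom x y) : sval f = sval g -> f = g.
Proof. by case: f g => [f hf] [g hg] /= fg; exact: eq_exist. Qed.

Lemma def_id_subproof A (x : def_ob A) :
  dphi x \oa amap (cmap X (to_k A)) (Arr (idm (dob x))) = dphi x.
Proof. by rewrite /amap /= fmor_id acompa1 // dphi_src. Qed.

Definition def_id A (x : def_ob A) : def_hom x x := exist _ _ (def_id_subproof x).

Lemma def_comp_subproof A (x y z : def_ob A) (g : def_hom y z) (f : def_hom x y) :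
  dphi z \oa amap (cmap X (to_k A)) (Arr (sval g \oc sval f)) = dphi x.
Proof.
rewrite -acompE amap_acomp // acompA //=; last by rewrite dphi_src.
by rewrite (svalP g) (svalP f).
Qed.

Definition def_comp A (x y z : def_ob A) (g : def_hom y z) (f : def_hom x y) : def_hom x z :=
  exist _ _ (def_comp_subproof g f).

Lemma def_comp1m A (x y : def_ob A) (f : def_hom x y) : def_comp (def_id y) f = f.
Proof. by apply: def_hom_ext; exact: comp1m. Qed.

Lemma def_compm1 A (x y : def_ob A) (f : def_hom x y) : def_comp f (def_id x) = f.
Proof. by apply: def_hom_ext; exact: compm1. Qed.

Lemma def_compA A (x y z w : def_ob A) (h : def_hom z w) (g : def_hom y z) (f : def_hom x y) :
  def_comp h (def_comp g f) = def_comp (def_comp h g) f.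
Proof. by apply: def_hom_ext; exact: compA. Qed.

Definition def_cat (A : CL) : category :=
  Category (@def_comp1m A) (@def_compm1 A) (@def_compA A).

Section DefMap.
Variables (A B : CL) (r : chom A B).

Lemma def_map_src (x : def_ob A) : src (dphi x) = cmap X (to_k B) (cmap X r (dob x)).
Proof. by rewrite ob_to_k dphi_src. Qed.

Definition def_map_ob (x : def_cat A) : def_cat B :=
  DefOb (def_map_src x) (dphi_tgt x) (dphi_iso x).

Lemma def_map_subproof (x y : def_ob A) (f : def_hom x y) :
  dphi y \oa amap (cmap X (to_k B)) (Arr (fmor (cmap X r) (sval f))) = dphi x.
Proof. by rewrite (amap_to_k r (Arr (sval f))) (svalP f). Qed.

Definition def_map_mor (x y : def_cat A) (f : hom x y) : hom (def_map_ob x) (def_map_ob y) :=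
  exist _ _ (def_map_subproof f).

Lemma def_map_id x : def_map_mor (idm x) = idm (def_map_ob x).
Proof. by apply: def_hom_ext; exact: fmor_id. Qed.

Lemma def_map_comp (x y z : def_cat A) (g : hom y z) (f : hom x y) :
  def_map_mor (g \oc f) = def_map_mor g \oc def_map_mor f.
Proof. by apply: def_hom_ext; exact: fmor_comp. Qed.

Definition def_map : functor (def_cat A) (def_cat B) := Functor def_map_id def_map_comp.
End DefMap.

Lemma def_arr_ext A (a b : arr (def_cat A)) :
  dphi (src a) = dphi (src b) -> dphi (tgt a) = dphi (tgt b) ->
  Arr (sval (amor a)) = Arr (sval (amor b)) -> a = b.
Proof.
case: a b => [[x p e1 e2 e3] [y q e4 e5 e6] [f hf]].
case=> [[x' p' e1' e2' e3'] [y' q' e4' e5' e6'] [f' hf']] /= ep eq e.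
have ex : x = x' := congr1 (@src _) e.
have ey : y = y' := congr1 (@tgt _) e.
move: e1 e2 e3 e4 e5 e6 f hf e1' e2' e3' e4' e5' e6' f' hf' e.
rewrite /def_hom /=.
case: _ / ex; case: _ / ey; case: _ / ep; case: _ / eq.
move=> e1 e2 e3 e4 e5 e6 f hf e1' e2' e3' e4' e5' e6' f' hf' /Arr_inj e.
case: _ / e hf' => hf'.
by rewrite (Prop_irrelevance e1' e1) (Prop_irrelevance e2' e2) (Prop_irrelevance e3' e3)
  (Prop_irrelevance e4' e4) (Prop_irrelevance e5' e5) (Prop_irrelevance e6' e6)
  (Prop_irrelevance hf' hf).
Qed.

Lemma def_cmap_id A (a : arr (def_cat A)) : amap (def_map (chom_id A)) a = a.
Proof. by apply: def_arr_ext => //=; exact: (cmap_id (Arr (sval (amor a)))). Qed.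

Lemma def_cmap_comp A B C (g : chom B C) (f : chom A B) (a : arr (def_cat A)) :
  amap (def_map (chom_comp g f)) a = amap (def_map g) (amap (def_map f) a).
Proof. by apply: def_arr_ext => //=; exact: (cmap_comp g f (Arr (sval (amor a)))). Qed.

Definition Def : cat_functor := CatFunctor def_cmap_id def_cmap_comp.
End Def.

Record sdc_data := SDCData {
  sdc :> nat -> set_functor;
  face : forall n i, (0 < i <= n)%N -> forall A, sdc n A -> sdc n.+1 A;
  degen : forall n i, (i < n)%N -> forall A, sdc n A -> sdc n.-1 A;
  sprod : forall m n A, sdc m A -> sdc n A -> sdc (m + n) A;
  sone : forall A, sdc 0 A }.

(* Equality of elements of E^m(A) and E^n(A) when m = n propositionally. *)
Definition graded_eq (E : sdc_data) A m n (x : E m A) (y : E n A) : Prop :=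
  Tagged (fun i => E i A) x = Tagged (fun i => E i A) y.

Local Notation "x =gr y" := (graded_eq x y) (at level 70).

Record is_sdc (E : sdc_data) : Prop := IsSDC {
  sdc_smooth : forall n, smooth (E n);
  sdc_homogeneous : forall n, homogeneous (E n);
  sdc_point : forall n, exists x : E n k, forall y, y = x;
  face_nat : forall n i (hi : (0 < i <= n)%N) A B (f : chom A B) (e : E n A),
    smap (E n.+1) f (face hi e) = face hi (smap (E n) f e);
  degen_nat : forall n i (hi : (i < n)%N) A B (f : chom A B) (e : E n A),
    smap (E n.-1) f (degen hi e) = degen hi (smap (E n) f e);
  sprod_nat : forall m n A B (f : chom A B) (e : E m A) (e' : E n A),
    smap (E (m + n)%N) f (sprod e e') = sprod (smap (E m) f e) (smap (E n) f e');
  sone_nat : forall A B (f : chom A B), smap (E 0) f (sone E A) = sone E B;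
  sprodA : forall m n p A (e : E m A) (f : E n A) (g : E p A),
    sprod (sprod e f) g =gr sprod e (sprod f g);
  sprod1l : forall n A (e : E n A), sprod (sone E A) e =gr e;
  sprod1r : forall n A (e : E n A), sprod e (sone E A) =gr e;
  face_face : forall n i j A (e : E n A) (hi : (0 < i <= n)%N) (hj : (0 < j <= n.+1)%N)
      (hj' : (0 < j.-1 <= n)%N) (hi' : (0 < i <= n.+1)%N),
    (i < j)%N -> face hj (face hi e) =gr face hi' (face hj' e);
  degen_degen : forall n i j A (e : E n A) (hi : (i < n)%N) (hj : (j < n.-1)%N)
      (hj' : (j.+1 < n)%N) (hi' : (i < n.-1)%N),
    (i <= j)%N -> degen hj (degen hi e) =gr degen hi' (degen hj' e);
  degen_face_lt : forall n i j A (e : E n A) (hi : (0 < i <= n)%N) (hj : (j < n.+1)%N)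
      (hj' : (j.-1 < n)%N) (hi' : (0 < i <= n.-1)%N),
    (i < j)%N -> degen hj (face hi e) =gr face hi' (degen hj' e);
  degen_face_eq : forall n i j A (e : E n A) (hi : (0 < i <= n)%N) (hj : (j < n.+1)%N),
    i = j \/ i = j.+1 -> degen hj (face hi e) =gr e;
  degen_face_gt : forall n i j A (e : E n A) (hi : (0 < i <= n)%N) (hj : (j < n.+1)%N)
      (hj' : (j < n)%N) (hi' : (0 < i.-1 <= n.-1)%N),
    (j.+1 < i)%N -> degen hj (face hi e) =gr face hi' (degen hj' e);
  face_sprodl : forall m n i A (e : E m A) (f : E n A) (hi : (0 < i <= m)%N)
      (hi' : (0 < i <= m + n)%N),
    sprod (face hi e) f =gr face hi' (sprod e f);
  face_sprodr : forall m n i A (e : E m A) (f : E n A) (hi : (0 < i <= n)%N)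
      (hi' : (0 < i + m <= m + n)%N),
    sprod e (face hi f) =gr face hi' (sprod e f);
  degen_sprodl : forall m n i A (e : E m A) (f : E n A) (hi : (i < m)%N)
      (hi' : (i < m + n)%N),
    sprod (degen hi e) f =gr degen hi' (sprod e f);
  degen_sprodr : forall m n i A (e : E m A) (f : E n A) (hi : (i < n)%N)
      (hi' : (i + m < m + n)%N),
    sprod e (degen hi f) =gr degen hi' (sprod e f) }.

Section DefE.
Variables (E : sdc_data) (sE : is_sdc E).

Lemma graded_eq_inj A n (x y : E n A) : x =gr y -> x = y.
Proof. exact: eq_from_Tagged. Qed.

Definition MC A : Type := {w : E 1 A | sprod w w = face (isT : (0 < 1 <= 1)%N) w :> E 2 A}.

(* [g * w * g^-1 = w'], where the inverse of [g] is exhibited. *)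
Definition gauge A (w w' : E 1 A) (g : E 0 A) : Prop :=
  exists h : E 0 A, [/\ sprod g h = sone E A, sprod h g = sone E A &
                        sprod (sprod g w) h = w'].

Definition mc_hom A (w w' : MC A) : Type := {g : E 0 A | gauge (sval w) (sval w') g}.

Lemma mc_hom_ext A (w w' : MC A) (f g : mc_hom w w') : sval f = sval g -> f = g.
Proof. by case: f g => [f hf] [g hg] /= fg; exact: eq_exist. Qed.

Let A00 n A (a b : E 0 A) (c : E n A) : sprod (sprod a b) c = sprod a (sprod b c).
Proof. by apply: (@graded_eq_inj A n); exact: (sprodA sE a b c). Qed.
Let A01 A (a c : E 0 A) (b : E 1 A) :
  sprod (sprod a b) c = sprod a (sprod b c) :> E 1 A.
Proof. by apply: (@graded_eq_inj A 1); exact: (sprodA sE a b c). Qed.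
Let A10 A (a : E 1 A) (b c : E 0 A) : sprod (sprod a b) c = sprod a (sprod b c) :> E 1 A.
Proof. by apply: (@graded_eq_inj A 1); exact: (sprodA sE a b c). Qed.
Let S1l n A (a : E n A) : sprod (sone E A) a = a.
Proof. by apply: (@graded_eq_inj A n); exact: (sprod1l sE a). Qed.
Let S1r0 A (a : E 0 A) : sprod a (sone E A) = a.
Proof. by apply: (@graded_eq_inj A 0); exact: (sprod1r sE a). Qed.
Let S1r1 A (a : E 1 A) : sprod a (sone E A) = a :> E 1 A.
Proof. by apply: (@graded_eq_inj A 1); exact: (sprod1r sE a). Qed.

Lemma mc_id_subproof A (w : MC A) : gauge (sval w) (sval w) (sone E A).
Proof. by exists (sone E A); rewrite !S1l; split=> //; exact: S1r1. Qed.

Definition mc_id A (w : MC A) : mc_hom w w := exist _ _ (mc_id_subproof w).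

Lemma mc_comp_subproof A (x y z : MC A) (g : mc_hom y z) (f : mc_hom x y) :
  gauge (sval x) (sval z) (sprod (sval g) (sval f)).
Proof.
case: f g => f [f' [ff' f'f fx]] [g [g' [gg' g'g gy]]]; exists (sprod f' g') => /=; split.
- have e : sprod f (sprod f' g') = g' :> E 0 A by rewrite -A00 ff' S1l.
  by rewrite A00 e.
- have e : sprod g' (sprod g f) = f :> E 0 A by rewrite -A00 g'g S1l.
  by rewrite A00 e.
- rewrite -gy -fx.
  rewrite (A00 g f (sval x)).
  rewrite -(A10 (sprod g (sprod f (sval x))) f' g').
  by rewrite (A01 g f' (sprod f (sval x))).
Qed.

Definition mc_comp A (x y z : MC A) (g : mc_hom y z) (f : mc_hom x y) : mc_hom x z :=
  exist _ _ (mc_comp_subproof g f).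

Lemma mc_comp1m A (x y : MC A) (f : mc_hom x y) : mc_comp (mc_id y) f = f.
Proof. by apply: mc_hom_ext; exact: S1l. Qed.

Lemma mc_compm1 A (x y : MC A) (f : mc_hom x y) : mc_comp f (mc_id x) = f.
Proof. by apply: mc_hom_ext; exact: S1r0. Qed.

Lemma mc_compA A (x y z w : MC A) (h : mc_hom z w) (g : mc_hom y z) (f : mc_hom x y) :
  mc_comp h (mc_comp g f) = mc_comp (mc_comp h g) f.
Proof. by apply: mc_hom_ext; rewrite /= A00. Qed.

Definition mc_cat (A : CL) : category :=
  Category (@mc_comp1m A) (@mc_compm1 A) (@mc_compA A).

Section McMap.
Variables (A B : CL) (r : chom A B).

Lemma mc_map_ob_subproof (w : MC A) :
  sprod (smap (E 1) r (sval w)) (smap (E 1) r (sval w))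
  = face (isT : (0 < 1 <= 1)%N) (smap (E 1) r (sval w)) :> E 2 B.
Proof.
by rewrite -(sprod_nat sE) -(face_nat sE) (svalP w).
Qed.

Definition mc_map_ob (w : mc_cat A) : mc_cat B := exist _ _ (mc_map_ob_subproof w).

Lemma mc_map_subproof (x y : MC A) (f : mc_hom x y) :
  gauge (smap (E 1) r (sval x)) (smap (E 1) r (sval y)) (smap (E 0) r (sval f)).
Proof.
case: f => g [h [gh hg gx]] /=; exists (smap (E 0) r h); split.
- by rewrite -(sprod_nat sE) gh (sone_nat sE).
- by rewrite -(sprod_nat sE) hg (sone_nat sE).
- by rewrite -gx -!(sprod_nat sE).
Qed.

Definition mc_map_mor (x y : mc_cat A) (f : hom x y) : hom (mc_map_ob x) (mc_map_ob y) :=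
  exist _ _ (mc_map_subproof f).

Lemma mc_map_id x : mc_map_mor (idm x) = idm (mc_map_ob x).
Proof. by apply: mc_hom_ext; exact: (sone_nat sE). Qed.

Lemma mc_map_comp (x y z : mc_cat A) (g : hom y z) (f : hom x y) :
  mc_map_mor (g \oc f) = mc_map_mor g \oc mc_map_mor f.
Proof. by apply: mc_hom_ext; exact: (sprod_nat sE r (sval g) (sval f)). Qed.

Definition mc_map : functor (mc_cat A) (mc_cat B) := Functor mc_map_id mc_map_comp.
End McMap.

Lemma mc_arr_ext A (a b : arr (mc_cat A)) :
  sval (src a) = sval (src b) -> sval (tgt a) = sval (tgt b) ->
  sval (amor a) = sval (amor b) -> a = b.
Proof.
case: a b => [[x hx] [y hy] [f hf]] [[x' hx'] [y' hy'] [f' hf']] /= ex ey ef.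
move: hx hy hf hx' hy' hf'; rewrite /mc_hom /=.
case: _ / ex; case: _ / ey; case: _ / ef => hx hy hf hx' hy' hf'.
by rewrite (Prop_irrelevance hx' hx) (Prop_irrelevance hy' hy) (Prop_irrelevance hf' hf).
Qed.

Lemma mc_cmap_id A (a : arr (mc_cat A)) : amap (mc_map (chom_id A)) a = a.
Proof. by apply: mc_arr_ext => /=; exact: smap_id. Qed.

Lemma mc_cmap_comp A B C (g : chom B C) (f : chom A B) (a : arr (mc_cat A)) :
  amap (mc_map (chom_comp g f)) a = amap (mc_map g) (amap (mc_map f) a).
Proof. by apply: mc_arr_ext => /=; exact: smap_comp. Qed.

Definition Def_sdc : cat_functor := CatFunctor mc_cmap_id mc_cmap_comp.
End DefE.

End FunctorsOnCLambda.

Section HomComplex.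
Variable L : complete_noetherian_local_ring.
Local Notation CL := (artalg L).
Local Notation k := (kobj L).
Variables (D B : cat_functor L) (U : cat_trans D B) (F : cat_trans B D).
Variable adj : functorial_adjunction U F.
Variables (D0 : D k) (b : lim_ob B) (alpha : hom (lim_at b k) (U k D0)).

Local Notation T A := (top (U A) (F A)).
Local Notation bt A := (bot (U A) (F A)).
Local Notation m A x := (mult (adj A) x).
Local Notation B_ A := (lim_at b A).

Lemma top_base A A' (f : chom A A') a :
  amap (cmap B f) (amap (T A) a) = amap (T A') (amap (cmap B f) a).
Proof. by rewrite !amap_functor_comp -ctrans_nat -ctrans_nat. Qed.

Lemma iter_top_base A A' (f : chom A A') n a :
  amap (cmap B f) (iter n (amap (T A)) a) = iter n (amap (T A')) (amap (cmap B f) a).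
Proof. by elim: n => //= n IH; rewrite top_base IH. Qed.

Lemma iter_top_base_ob A A' (f : chom A A') n x :
  cmap B f (iter n (T A) x) = iter n (T A') (cmap B f x).
Proof.
have := congr1 (@src _) (iter_top_base f n (Arr (idm x))).
by rewrite /= !src_iter.
Qed.

Lemma mult_base A A' (f : chom A A') x :
  amap (cmap B f) (Arr (m A x)) = Arr (m A' (cmap B f x)).
Proof.
rewrite -(ctrans_nat U f (Arr (adj_counit (adj A) (F A x)))) counit_base.
by rewrite -(ctrans_nat_ob F).
Qed.

(* eps_D o ... o eps_(bot^(n-1) D), as a morphism top^n (U D) -> U D of B(k). *)
Definition hom_beta (n : nat) : arr (B k) := amap (U k) (Arr (counit_iter (adj k) D0 n)).

(* Fibre over [hom_beta n], with the image of [b] in [B k] identified with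
   [U D0] by [alpha]. *)
Definition over_beta (n : nat) (A : CL) (a : arr (B A)) : Prop :=
  [/\ src a = iter n (T A) (B_ A), tgt a = B_ A &
      Arr alpha \oa amap (cmap B (to_k A)) a = hom_beta n \oa iter n (amap (T k)) (Arr alpha)].

Definition hom_set (n : nat) (A : CL) : Type := {a : arr (B A) | over_beta n a}.

Lemma hom_set_ext n A (x y : hom_set n A) : sval x = sval y -> x = y.
Proof. by case: x y => [x hx] [y hy] /= xy; exact: eq_exist. Qed.

Lemma hom_map_subproof n A A' (f : chom A A') (x : hom_set n A) :
  over_beta n (amap (cmap B f) (sval x)).
Proof.
case: x => a [sa ta oa] /=; split=> /=.
- by rewrite sa iter_top_base_ob cmap_lim_at.
- by rewrite ta cmap_lim_at.
- by rewrite amap_to_k.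
Qed.

Definition hom_map n A A' (f : chom A A') (x : hom_set n A) : hom_set n A' :=
  exist _ _ (hom_map_subproof f x).

Lemma hom_map_id n A (x : hom_set n A) : hom_map (chom_id A) x = x.
Proof. by apply: hom_set_ext; exact: cmap_id. Qed.

Lemma hom_map_comp n A A' A'' (g : chom A' A'') (f : chom A A') (x : hom_set n A) :
  hom_map (chom_comp g f) x = hom_map g (hom_map f x).
Proof. by apply: hom_set_ext; exact: cmap_comp. Qed.

Definition hom_functor (n : nat) : set_functor L :=
  SetFunctor (@hom_map_id n) (@hom_map_comp n).

Lemma iter_bot_ob n : iter n (T k) (U k D0) = U k (iter n (bt k) D0).
Proof. by elim: n => //= n ->. Qed.

Lemma src_beta n : src (hom_beta n) = iter n (T k) (U k D0).
Proof. by rewrite iter_bot_ob. Qed.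

Lemma iter_topU n (a : arr (D k)) :
  iter n (amap (T k)) (amap (U k) a) = amap (U k) (iter n (amap (bt k)) a).
Proof. by elim: n => //= n ->. Qed.

Lemma counit_iterS n : Arr (counit_iter (adj k) D0 n.+1)
  = Arr (counit_iter (adj k) D0 n) \oa Arr (adj_counit (adj k) (iter n (bt k) D0)).
Proof. by rewrite acompE. Qed.

Lemma counit_iterD p q :
  Arr (counit_iter (adj k) D0 (p + q))
  = Arr (counit_iter (adj k) D0 p) \oa
    iter p (amap (bt k)) (Arr (counit_iter (adj k) D0 q)).
Proof.
elim: p => [|p IH]; first by rewrite /= acompE comp1m.
rewrite addSn !counit_iterS IH iterD -!acompA ?tgt_iter ?src_iter //.
congr (_ \oa _); rewrite iterS.
by have := counit_anat (adj k) (iter p (amap (bt k)) (Arr (counit_iter (adj k) D0 q)));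
  rewrite tgt_iter src_iter => ->.
Qed.

Lemma beta_comp p q : hom_beta p \oa iter p (amap (T k)) (hom_beta q) = hom_beta (p + q).
Proof.
rewrite /hom_beta iter_topU -amap_acomp; last by rewrite tgt_iter.
by rewrite -counit_iterD.
Qed.

Lemma sprod_subproof p q A (g : hom_set p A) (h : hom_set q A) :
  over_beta (p + q) (sval g \oa iter p (amap (T A)) (sval h)).
Proof.
case: g h => g [sg tg og] [h [sh th oh]] /=.
have e : tgt (iter p (amap (T A)) h) = src g by rewrite tgt_iter th sg.
split; first by rewrite src_acomp // src_iter sh iterD.
  by rewrite tgt_acomp.
have e1 : tgt (amap (cmap B (to_k A)) h) = lim_at b k by rewrite /= th cmap_lim_at.
rewrite amap_acomp // iter_top_base acompA; last 2 first.
- by rewrite tgt_iter e1 /= sg iter_top_base_ob cmap_lim_at.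
- by rewrite /= tg cmap_lim_at.
rewrite og -acompA; last 2 first.
- by rewrite tgt_iter e1 src_iter.
- by rewrite tgt_iter src_beta.
rewrite -iter_acomp; last by rewrite e1.
rewrite oh iter_acomp; last by rewrite tgt_iter src_beta.
rewrite -iterD acompA ?beta_comp //.
  by rewrite tgt_iter src_iter src_beta iterD.
by rewrite tgt_iter src_beta.
Qed.

Definition hom_sprod p q A (g : hom_functor p A) (h : hom_functor q A) :
    hom_functor (p + q) A := exist _ _ (sprod_subproof g h).

Lemma sone_subproof A : over_beta 0 (Arr (idm (B_ A))).
Proof.
split=> //; rewrite /amap /= fmor_id acompa1 /=; last by rewrite cmap_lim_at.
by rewrite /hom_beta /amap /= fmor_id acomp1a.
Qed.

Definition hom_sone A : hom_functor 0 A := exist _ _ (sone_subproof A).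

(* g o top^(i-1) (U eps_(F top^(n-i) B)) *)
Definition face_arr n i A (g : arr (B A)) : arr (B A) :=
  g \oa iter i.-1 (amap (T A))
          (Arr (fmor (U A) (adj_counit (adj A) (F A (iter (n - i) (T A) (B_ A)))))).

Lemma face_subproof n i (hi : (0 < i <= n)%N) A (g : hom_set n A) :
  over_beta n.+1 (face_arr n i (sval g)).
Proof.
case: i hi => [|p] // /andP[_ pn]; have /subnKC := pn.
rewrite /face_arr succnK; move: (n - p.+1)%N => q e; case: _ / e g {pn} => g.
case: g => g [sg tg og] /=; set x := iter q (T A) (B_ A).
rewrite -/(m A x).
have e0 : tgt (iter p (amap (T A)) (Arr (m A x))) = src g.
  by rewrite tgt_iter /= sg addSn -addnS iterD.
split.
- by rewrite src_acomp // src_iter addSn -!addnS iterD.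
- by rewrite tgt_acomp.
rewrite amap_acomp // iter_top_base mult_base /x iter_top_base_ob cmap_lim_at; clear e0 x.
set x := iter q (T k) (B_ k).
rewrite acompA; last 2 first.
- by rewrite tgt_iter /= sg iter_top_base_ob cmap_lim_at addSn -addnS iterD.
- by rewrite /= tg cmap_lim_at.
pose y := iter q (T k) (U k D0).
have nat : iter q.+1 (amap (T k)) (Arr alpha) \oa Arr (m k x)
    = Arr (m k y) \oa iter q.+2 (amap (T k)) (Arr alpha).
  have := mult_anat (adj k) (iter q (amap (T k)) (Arr alpha)).
  by rewrite src_iter tgt_iter => ->.
rewrite og -acompA; last 2 first.
- by rewrite tgt_iter src_iter addSn -addnS iterD.
- by rewrite tgt_iter src_beta.
have -> : iter (p.+1 + q) (amap (T k)) (Arr alpha)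
    = iter p (amap (T k)) (iter q.+1 (amap (T k)) (Arr alpha)) by rewrite -iterD addnS.
rewrite -iter_acomp; last by rewrite src_iter.
rewrite nat iter_acomp; last by rewrite tgt_iter.
rewrite -iterD acompA; last 2 first.
- by rewrite tgt_iter src_iter /= iterD.
- by rewrite tgt_iter src_beta addSn -addnS iterD.
have mE : Arr (m k y) = amap (U k) (Arr (adj_counit (adj k) (iter q.+1 (bt k) D0))).
  by rewrite /mult /y iter_bot_ob.
have eS : hom_beta q.+1 \oa Arr (m k y) = hom_beta q.+2.
  by rewrite mE /hom_beta -amap_acomp // -counit_iterS.
have -> : (p.+1 + q).+1 = (p + q.+2)%N by rewrite !addnS addSn.
have -> : (p.+1 + q)%N = (p + q.+1)%N by rewrite addnS addSn.
rewrite -!beta_comp -eS iter_acomp; last by rewrite src_beta.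
rewrite [in RHS]acompA //; first by rewrite !tgt_iter src_iter src_beta.
by rewrite tgt_iter src_beta.
Qed.

Definition hom_face n i (hi : (0 < i <= n)%N) A (g : hom_functor n A) : hom_functor n.+1 A :=
  exist _ _ (face_subproof hi g).

(* g o top^i (eta_(top^(n-i-1) B)) *)
Definition degen_arr n i A (g : arr (B A)) : arr (B A) :=
  g \oa iter i (amap (T A)) (Arr (adj_unit (adj A) (iter (n - i - 1) (T A) (B_ A)))).

Lemma degen_subproof n i (hi : (i < n)%N) A (g : hom_set n A) :
  over_beta n.-1 (degen_arr n i (sval g)).
Proof.
rewrite /degen_arr -subnDA addn1; have /subnKC := hi.
move: (n - i.+1)%N => q e; case: _ / e g {hi} => g.
case: g => g [sg tg og] /=; set x := iter q (T A) (B_ A).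
have e0 : tgt (iter i (amap (T A)) (Arr (adj_unit (adj A) x))) = src g.
  by rewrite tgt_iter /= sg addSn -addnS iterD.
split.
- by rewrite src_acomp // src_iter iterD.
- by rewrite tgt_acomp.
rewrite amap_acomp // iter_top_base unit_base /x iter_top_base_ob cmap_lim_at; clear e0 x.
set x := iter q (T k) (B_ k).
rewrite acompA; last 2 first.
- by rewrite tgt_iter /= sg iter_top_base_ob cmap_lim_at addSn -addnS iterD.
- by rewrite /= tg cmap_lim_at.
pose y := iter q (T k) (U k D0).
have nat : iter q.+1 (amap (T k)) (Arr alpha) \oa Arr (adj_unit (adj k) x)
    = Arr (adj_unit (adj k) y) \oa iter q (amap (T k)) (Arr alpha).
  have := unit_anat (adj k) (iter q (amap (T k)) (Arr alpha)).
  by rewrite src_iter tgt_iter => ->.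
rewrite og -acompA; last 2 first.
- by rewrite tgt_iter src_iter addSn -addnS iterD.
- by rewrite tgt_iter src_beta.
have -> : iter (i.+1 + q) (amap (T k)) (Arr alpha)
    = iter i (amap (T k)) (iter q.+1 (amap (T k)) (Arr alpha)) by rewrite -iterD addnS.
rewrite -iter_acomp; last by rewrite src_iter.
rewrite nat iter_acomp; last by rewrite tgt_iter.
rewrite -iterD acompA; last 2 first.
- by rewrite tgt_iter src_iter /= iterD.
- by rewrite tgt_iter src_beta addSn -addnS iterD.
congr (_ \oa _).
rewrite addSn -addnS -!beta_comp -acompA; last 2 first.
- by rewrite !tgt_iter src_iter src_beta.
- by rewrite !tgt_iter src_beta.
rewrite -iter_acomp; last by rewrite src_beta.
congr (_ \oa iter i _ _).
rewrite /hom_beta /= -acompE amap_acomp //.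
rewrite -acompA; last 2 first.
- by rewrite /= /y iter_bot_ob.
- by [].
rewrite /y iter_bot_ob /amap /= acompE triangleU.
by rewrite acompE compm1.
Qed.

Definition hom_degen n i (hi : (i < n)%N) A (g : hom_functor n A) : hom_functor n.-1 A :=
  exist _ _ (degen_subproof hi g).

Definition hom_sdc_data : sdc_data L :=
  SDCData hom_face hom_degen hom_sprod hom_sone.
End HomComplex.

(* Main.v *)
From HB Require Import structures.
From mathcomp Require Import all_boot all_algebra.
From mathcomp Require Import boolp classical_sets.
From mathcomp Require Import ring zify.
Require Import Defs.

(** Morphisms and isomorphism classes of the categories B(A) carry no moduli, so
    an object of D(A) that deforms D has an underlying object isomorphic to the
    fixed lift B(A), by an isomorphism that lifts the given one over k.  By
    monadicity all the information that is left is a top-algebra structure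
    w : top B(A) -> B(A) that deforms the one of UD.  Associativity of w is the
    Maurer-Cartan equation, the comparison of two algebra structures is the gauge
    action, and a change of the chosen isomorphism changes w by a gauge
    transformation.  Three points need an argument.

    Invertibility.  A morphism of B(A) whose image over k is invertible is
    invertible ([to_k_reflects_iso]).  This makes E^0(A) a group, makes lifts of
    isomorphisms isomorphisms, and, as U reflects isomorphisms, makes the
    deformations of D a groupoid.  Since inverses lift by fullness and the
    maximal ideal of A is nilpotent, it reduces to an endomorphism e that is the
    identity modulo an ideal I with I^2 = 0.  Then (a, b, c) |-> a - b + c is a
    ring morphism from A x_(A/I) A x_(A/I) A to A, and homogeneity gives a map p
    on triples of endomorphisms that agree modulo I.  It respects composition and
    satisfies p(x, y, y) = x and p(y, y, x) = x, so that
    p(1, e, 1) e = p(1, e, 1) p(e, 1, 1) = p(e, e, 1) = 1, and in the same way on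
    the other side ([square_zero_unipotent]).

    The unit law.  The Maurer-Cartan equation is only associativity.  It implies
    that w o eta is idempotent; being an element of the group E^0(A), it is 1
    ([mc_unit]).

    Functoriality.  The isomorphism UX -> B(A) is a choice, which need not be
    compatible with base change, so the comparison is only pseudo-natural.  The
    algebra structures and morphisms are therefore described for an arbitrary
    isomorphism t ([framing]), and all coherence conditions become instances of
    one composition law ([transport_comp]) and of base change ([transport_map]).

    The axioms of a simplicial deformation complex are the naturality of the
    multiplication and of the unit of top, and the monad laws ([hom_is_sdc]).
    Smoothness and homogeneity of E^n come from fullness of the base change
    functors and homogeneity of Mor B. *)

Set Implicit Arguments.
Unset Strict Implicit.
Unset Printing Implicit Defensive.

Import GRing.Theory.
Local Open Scope ring_scope.
Local Open Scope classical_set_scope.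

(** * Fibre products and quotients of Artinian algebras *)

Lemma image_ideal (R S : comNzRingType) (h : {rmorphism R -> S}) (I : set R) :
  surjective h -> is_ideal I -> is_ideal (h @` I).
Proof.
move=> hs [I0 ID IM]; split.
- by exists 0; rewrite ?rmorph0.
- by move=> _ _ [x Ix <-] [y Iy <-]; exists (x + y); rewrite ?rmorphD //; exact: ID.
- move=> s _ [x Ix <-]; have [a <-] := hs s.
  by exists (a * x); rewrite ?rmorphM //; exact: IM.
Qed.

Lemma inter_ideal (R : comNzRingType) (I J : set R) :
  is_ideal I -> is_ideal J -> is_ideal (I `&` J).
Proof.
move=> [I0 ID IM] [J0 JD JM]; split=> //.
  by move=> x y [? ?] [? ?]; split; [exact: ID|exact: JD].
by move=> a x [? ?]; split; [exact: IM|exact: JM].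
Qed.

(** Used with J the maximal ideal of a quotient: the nilpotency order of the
    maximal ideal does not grow in a quotient. *)
Lemma ideal_pow_image (R S : comNzRingType) (h : {rmorphism R -> S})
    (I : set R) (J : set S) n :
  surjective h -> (forall x, J (h x) -> I x) -> ideal_pow J n `<=` h @` ideal_pow I n.
Proof.
move=> hs IJ; elim: n => [|n IH] y; first by move=> _; have [x <-] := hs y; exists x.
apply; first by apply: image_ideal => //; exact: ideal_powP.
move=> _ [a [b [Ja /IH[b' Ib' <-] ->]]]; have [a' a'E] := hs a.
exists (a' * b'); last by rewrite rmorphM a'E.
by move=> K KI; apply; exists a', b'; split=> //; apply: IJ; rewrite a'E.
Qed.

(** The map to the residue field is the only one, so every morphism commutes
    with it. *)
Lemma chom_res (L : complete_noetherian_local_ring) (X Y : artalg L) (h : chom X Y) x :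
  ares Y (h x) = ares X x.
Proof.
exact: (congr1 (fun u : chom X (kobj L) => u x) (to_k_uniq (chom_comp (to_k Y) h))).
Qed.

Section FibreProduct.
Variables (L : complete_noetherian_local_ring) (A B C : artalg L).
Variables (f : chom B A) (g : chom C A).

Definition fibre_pred : {pred B * C} := fun x => f x.1 == g x.2.

Lemma fibre_subring : subring_closed fibre_pred.
Proof.
split; rewrite ?unfold_in /=; first by rewrite !rmorph1.
- by move=> x y /eqP xE /eqP yE; rewrite unfold_in /= !rmorphB xE yE.
- by move=> x y /eqP xE /eqP yE; rewrite unfold_in /= !rmorphM xE yE.
Qed.

HB.instance Definition _ :=
  GRing.isSubringClosed.Build (B * C)%type fibre_pred fibre_subring.

Record fibre := Fibre { fibre_val : B * C; fibreP : fibre_val \in fibre_pred }.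
HB.instance Definition _ := [isSub for fibre_val].
HB.instance Definition _ := [Choice of fibre by <:].
HB.instance Definition _ := [SubChoice_isSubComNzRing of fibre by <:].

Lemma fibre_ext (x y : fibre) :
  (val x).1 = (val y).1 -> (val x).2 = (val y).2 -> x = y.
Proof. by move=> e1 e2; apply: val_inj; case: (val x) (val y) e1 e2 => ? ? [? ?] /= -> ->. Qed.

Lemma fibre_eq (x : fibre) : f (val x).1 = g (val x).2.
Proof. exact: (eqP (fibreP x)). Qed.

Definition fibre_mk b c (e : f b = g c) : fibre :=
  @Fibre (b, c) (introT eqP e : (b, c) \in fibre_pred).

Definition fibre_proj1 : {rmorphism fibre -> B} := (@fst B C) \o val.
Definition fibre_proj2 : {rmorphism fibre -> C} := (@snd B C) \o val.

Lemma fibre_str_eq (x : L) : f (astr B x) = g (astr C x).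
Proof. by rewrite !chom_str. Qed.

Definition fibre_str_fun x : fibre := fibre_mk (fibre_str_eq x).

Lemma fibre_str_zmod : zmod_morphism fibre_str_fun.
Proof. by move=> x y; apply: fibre_ext; rewrite /= rmorphB. Qed.

Lemma fibre_str_monoid : monoid_morphism fibre_str_fun.
Proof. by split=> [|x y]; apply: fibre_ext; rewrite /= ?rmorph1 ?rmorphM. Qed.

HB.instance Definition _ :=
  GRing.isZmodMorphism.Build L fibre fibre_str_fun fibre_str_zmod.
HB.instance Definition _ :=
  GRing.isMonoidMorphism.Build L fibre fibre_str_fun fibre_str_monoid.

Definition fibre_str : {rmorphism L -> fibre} := fibre_str_fun.
Definition fibre_res : {rmorphism fibre -> residue_field L} := ares B \o fibre_proj1.

Lemma fibre_res_str x : fibre_res (fibre_str x) = qproj (mu_pideal L) x.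
Proof. exact: ares_str. Qed.

Lemma fibre_local : local_ring [set x | fibre_res x = 0].
Proof.
apply: local_intro.
- exact: preimage_ideal (zero_ideal _).
- by move=> /eqP; rewrite (rmorph1 fibre_res) oner_eq0.
- move=> x x0.
  have [b bx] := local_unit (alocal B) x0.
  have [|c cx] := @local_unit _ _ (val x).2 (alocal C).
    by rewrite /= -(chom_res g) -fibre_eq chom_res.
  have e : f b = g c.
    have gc : g c * f (val x).1 = 1 by rewrite fibre_eq mulrC -rmorphM cx rmorph1.
    by rewrite -[f b]mul1r -gc -mulrA -rmorphM bx rmorph1 mulr1.
  exists (fibre_mk e).
  by apply: fibre_ext.
Qed.

Hypotheses (f_surj : surjective f) (g_surj : surjective g).

Lemma fibre_proj1_surj : surjective fibre_proj1.
Proof. by move=> b; have [c e] := g_surj (f b); exists (fibre_mk (esym e)). Qed.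

Lemma fibre_proj2_surj : surjective fibre_proj2.
Proof. by move=> c; have [b e] := f_surj (g c); exists (fibre_mk e). Qed.

(** A descending chain of ideals I_n of B x_A C is controlled by two chains: the
    images of the I_n in B, and the images in C of the parts of the I_n that die
    in B.  Both are chains of ideals because both projections are surjective. *)
Lemma fibre_artinian : artinian fibre.
Proof.
move=> I II dI.
have kerI : is_ideal [set x | fibre_proj1 x = 0] by exact: preimage_ideal (zero_ideal _).
have [N1 h1] := aartinian (fun n => image_ideal fibre_proj1_surj (II n))
  (fun n => image_subset (dI n)).
have [|N2 h2] := aartinian
    (fun n => image_ideal fibre_proj2_surj (inter_ideal (II n) kerI)).
  by move=> n; apply: image_subset => x [Ix kx]; split=> //; exact: dI.
exists (maxn N1 N2) => n; rewrite geq_max => /andP[n1 n2].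
apply/seteqP; split; first by apply: decr_sub => //; rewrite geq_max n1.
move=> x Ix; set N := maxn N1 N2 in Ix.
have [y Iy yx] : (fibre_proj1 @` I n) (fibre_proj1 x).
  by rewrite h1 // -(h1 N) ?leq_maxl //; exists x.
have IN : I N `<=` I N2 := decr_sub dI (leq_maxr _ _).
have Iny : I N y by apply: decr_sub Iy => //; rewrite geq_max n1.
have [z [Iz z0] zx] :
    (fibre_proj2 @` (I n `&` [set x | fibre_proj1 x = 0])) (fibre_proj2 (x - y)).
  rewrite h2 //; exists (x - y) => //; split; last by rewrite /mkset rmorphB yx subrr.
  by apply: IN; apply: ideal_subr.
(* x and its lift y from the deeper term have the same image in B, and z accounts
   for their difference. *)
have -> : x = y + z.
  apply: fibre_ext.
    by rewrite -[LHS]/(fibre_proj1 x) -[RHS]/(fibre_proj1 (y + z)) rmorphD z0 addr0.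
  rewrite -[LHS]/(fibre_proj2 x) -[RHS]/(fibre_proj2 (y + z)) rmorphD zx rmorphB.
  by rewrite addrC subrK.
by case: (II n) => _ + _; apply.
Qed.

Definition fibre_obj : artalg L :=
  @ArtAlg L fibre fibre_str fibre_res fibre_res_str fibre_local fibre_artinian.

Definition fibre_hom1 : chom fibre_obj B := @CHom L fibre_obj B fibre_proj1 (fun=> erefl).
Definition fibre_hom2 : chom fibre_obj C := @CHom L fibre_obj C fibre_proj2 (fun=> erefl).

Lemma fibre_objP : is_fibre_product f g fibre_hom1 fibre_hom2.
Proof.
split=> [x|b c e]; first exact: fibre_eq.
exists (fibre_mk e); split=> // y [y1 y2].
exact: fibre_ext.
Qed.
End FibreProduct.

Lemma fibre_product_exists (L : complete_noetherian_local_ring) (A B C : artalg L)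
    (f : chom B A) (g : chom C A) : surjective f -> surjective g ->
  exists (P : artalg L) (p : chom P B) (q : chom P C),
    is_fibre_product f g p q /\ surjective p.
Proof.
move=> fs gs; exists (fibre_obj fs gs), (fibre_hom1 fs gs), (fibre_hom2 fs gs).
by split; [exact: fibre_objP|exact: fibre_proj1_surj].
Qed.

Section Mediating.
Variables (L : complete_noetherian_local_ring) (A B C P : artalg L).
Variables (f : chom B A) (g : chom C A) (p : chom P B) (q : chom P C).
Hypothesis fp : is_fibre_product f g p q.

Lemma fibre_product_inj x y : p x = p y -> q x = q y -> x = y.
Proof.
move=> e1 e2; have [z [_ zu]] := fp.2 (p y) (q y) (fp.1 y).
by rewrite -(zu x) ?(zu y).
Qed.

Lemma fibre_product_mediate (R : artalg L) (u : chom R B) (v : chom R C) :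
  (forall x, f (u x) = g (v x)) ->
  exists w : chom R P, (forall x, p (w x) = u x) /\ (forall x, q (w x) = v x).
Proof.
move=> e.
have hx x : exists y, p y = u x /\ q y = v x.
  by have [y [hy _]] := fp.2 _ _ (e x); exists y.
have [w hw] := choice hx.
have w1 x : p (w x) = u x by case: (hw x).
have w2 x : q (w x) = v x by case: (hw x).
have wB : zmod_morphism w.
  by move=> x y; apply: fibre_product_inj; rewrite !(rmorphB, w1, w2).
have wM : monoid_morphism w.
  by split=> [|x y]; apply: fibre_product_inj; rewrite !(rmorph1, rmorphM, w1, w2).
pose wr : {rmorphism R -> P} := HB.pack w (GRing.isZmodMorphism.Build R P w wB)
  (GRing.isMonoidMorphism.Build R P w wM).
have ws x : wr (astr R x) = astr P x.
  by apply: fibre_product_inj; rewrite (w1, w2) !chom_str.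
by exists (CHom ws).
Qed.

Lemma homogeneous_inj (X : set_functor L) : homogeneous X -> surjective f ->
  forall x y : X P, smap p x = smap p y -> smap q x = smap q y -> x = y.
Proof.
move=> hX fs x y e1 e2.
have e : smap f (smap p y) = smap g (smap q y).
  rewrite -!smap_comp; congr (smap _ y).
  by apply: chom_ext => z; exact: fp.1.
have [z [_ zu]] := hX _ _ _ _ _ _ _ _ fs fp _ _ e.
by rewrite -(zu x) ?(zu y).
Qed.
End Mediating.

Section Quotient.
Variables (L : complete_noetherian_local_ring) (A : artalg L).
Local Notation m := [set a | ares A a = 0].
Variables (I : pideal A) (Im : I `<=` m).

Lemma aquot_res_subproof x : I x -> ares A x = 0.
Proof. by move=> Ix; exact: Im. Qed.

Definition aquot_res : {rmorphism quot_ring I -> residue_field L} := qlift aquot_res_subproof.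
Definition aquot_str : {rmorphism L -> quot_ring I} := qproj I \o astr A.

Lemma aquot_res_str x : aquot_res (aquot_str x) = qproj (mu_pideal L) x.
Proof. by rewrite -(ares_str A); exact: qlift_proj. Qed.

Lemma aquot_local : local_ring [set a | aquot_res a = 0].
Proof.
apply: local_intro.
- exact: preimage_ideal (zero_ideal _).
- by move=> /eqP; rewrite (rmorph1 aquot_res) oner_eq0.
- move=> a; have [x <-] := qproj_surj a; rewrite /mkset /= qlift_proj => mx.
  have [y xy] := local_unit (alocal A) mx.
  by exists (qproj I y); rewrite -rmorphM xy rmorph1.
Qed.

Lemma aquot_artinian : artinian (quot_ring I).
Proof.
move=> J JI dJ.
have [N hN] := @aartinian L A (fun n => [set x | J n (qproj I x)])
  (fun n => preimage_ideal (qproj I) (JI n)) (fun n x => @dJ n _).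
exists N => n Nn; apply/seteqP; split=> a; have [x <-] := qproj_surj a => Jx.
  by have : [set x | J n (qproj I x)] x by []; rewrite hN.
by have : [set x | J N (qproj I x)] x by []; rewrite -(hN n).
Qed.

Definition aquot_obj : artalg L := ArtAlg aquot_res_str aquot_local aquot_artinian.
Definition aquot_hom : chom A aquot_obj := @CHom L A aquot_obj (qproj I) (fun=> erefl).
End Quotient.

(** The ternary operation a - b + c on triples that agree modulo a square-zero
    ideal; it is the ring-theoretic source of the inverses below. *)
Section Malcev.
Variables (R S P : comNzRingType) (f : {rmorphism R -> S}).
Variables (c1 c2 c3 : {rmorphism P -> R}).
Hypotheses (e12 : forall x, f (c1 x) = f (c2 x)) (e23 : forall x, f (c2 x) = f (c3 x)).
Hypothesis sq0 : forall x y, f x = 0 -> f y = 0 -> x * y = 0.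

Definition malcev_fun x := c1 x - c2 x + c3 x.

Lemma malcev_zmod : zmod_morphism malcev_fun.
Proof. by move=> x y; rewrite /malcev_fun !rmorphB; ring. Qed.

(** With b as base point, the triple is (b + i, b, b + j) and its image is
    b + i + j, so the failure to be multiplicative is the sum of the products
    i j' and j i', which vanish. *)
Lemma malcev_monoid : monoid_morphism malcev_fun.
Proof.
split=> [|x y]; rewrite /malcev_fun ?rmorph1 ?subrr ?add0r // !rmorphM.
have k1 z : f (c1 z - c2 z) = 0 by rewrite rmorphB e12 subrr.
have k2 z : f (c3 z - c2 z) = 0 by rewrite rmorphB e23 subrr.
have := sq0 (k1 x) (k2 y); have := sq0 (k2 x) (k1 y).
move=> h1 h2; apply/eqP; rewrite -subr_eq0; apply/eqP.
rewrite -[RHS]oppr0 -[in RHS](addr0 0) -{1}h1 -h2; ring.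
Qed.

HB.instance Definition _ := GRing.isZmodMorphism.Build P R malcev_fun malcev_zmod.
HB.instance Definition _ := GRing.isMonoidMorphism.Build P R malcev_fun malcev_monoid.

Definition malcev : {rmorphism P -> R} := malcev_fun.

Lemma malcevE x : malcev x = c1 x - c2 x + c3 x.
Proof. by []. Qed.
End Malcev.

(** * Isomorphisms in a category, as arrows with endpoints *)

Definition arr_iso (C : category) (a : arr C) : Prop := is_iso (amor a).

Section ArrIso.
Variable C : category.
Implicit Types (a b c : arr C) (x y : C).

Lemma arr_isoP a : arr_iso a <->
  exists b, [/\ src b = tgt a, tgt b = src a, b \oa a = Arr (idm (src a))
              & a \oa b = Arr (idm (tgt a))].
Proof.
case: a => x y f; split=> [[g [gf fg]]|[b [sb tb ba ab]]].
  by exists (Arr g); rewrite /= !acompE gf fg.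
have [g gE] := arrP sb tb; exists g => /=.
by move: ba ab; rewrite gE !acompE /= => /Arr_inj -> /Arr_inj ->.
Qed.

Lemma src_amap (C' : category) (F : functor C C') a : src (amap F a) = F (src a).
Proof. by []. Qed.

Lemma tgt_amap (C' : category) (F : functor C C') a : tgt (amap F a) = F (tgt a).
Proof. by []. Qed.

Lemma amap_idm (C' : category) (F : functor C C') x :
  amap F (Arr (idm x)) = Arr (idm (F x)).
Proof. by rewrite /amap /= fmor_id. Qed.

Lemma full_lift (C' : category) (F : functor C C') (b : arr C') x y : full F ->
  src b = F x -> tgt b = F y -> exists h : hom x y, amap F (Arr h) = b.
Proof.
move=> hF sb tb; have [g ->] := arrP sb tb.
by have [h hE] := hF _ _ g; exists h; rewrite /amap /= hE.
Qed.

Lemma iso_amap (C' : category) (F : functor C C') x y (h : hom x y) :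
  is_iso h -> is_iso (fmor F h).
Proof. by move=> [g [gh hg]]; exists (fmor F g); rewrite -!fmor_comp gh hg !fmor_id. Qed.

Lemma iso_comp x y z (g : hom y z) (h : hom x y) : is_iso g -> is_iso h -> is_iso (g \oc h).
Proof.
move=> [g' [g'g gg']] [h' [h'h hh']]; exists (h' \oc g'); split.
  by rewrite -compA (compA g') g'g comp1m.
by rewrite -compA (compA h) hh' comp1m.
Qed.

Lemma iso_of_inverses x y (h : hom x y) (g g' : hom y x) :
  is_iso (g \oc h) -> is_iso (h \oc g') -> is_iso h.
Proof.
move=> [u [u1 u2]] [v [v1 v2]].
exists (u \oc g); split; first by rewrite -compA.
have e : u \oc g = g' \oc v.
  by rewrite -[RHS]comp1m -u1 -compA -(compA g) (compA h) v2 compm1.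
by rewrite e compA.
Qed.
End ArrIso.

(** * Invertibility is detected over the residue field *)

Section Lifting.
Variables (L : complete_noetherian_local_ring) (X : cat_functor L).
Hypothesis X_hom : homogeneous (Mor X).

(** Objects embed into morphisms as identities, so homogeneity of Mor X also
    separates objects. *)
Lemma mor_ob_inj (A B C P : artalg L) (f : chom B A) (g : chom C A)
    (p : chom P B) (q : chom P C) : is_fibre_product f g p q -> surjective f ->
  forall x y : X P, cmap X p x = cmap X p y -> cmap X q x = cmap X q y -> x = y.
Proof.
move=> fp fs x y e1 e2.
have id r (Q : artalg L) (h : chom P Q) :
    smap (s := Mor X) h (Arr (idm r)) = Arr (idm (cmap X h r)).
  exact: amap_idm.
apply: (congr1 (@src _) (x := Arr (idm x)) (y := Arr (idm y))).
by apply: (homogeneous_inj fp X_hom fs); rewrite !id (e1, e2).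
Qed.

(** Writing e1, e2, e3 for a triple of endomorphisms of x that agree modulo the
    kernel of f, homogeneity turns it into one endomorphism over
    A x_A' A x_A' A.  There (1, e, 1) (e, 1, 1) = (e, e, 1), and the ring morphism
    a - b + c, which sends (x, y, y) and (y, y, x) to x, maps this identity to
    g e = 1, where g is the image of (1, e, 1). *)
Lemma square_zero_unipotent (A A' : artalg L) (f : chom A A') (x : X A) (e : hom x x) :
  surjective f -> (forall a b, f a = 0 -> f b = 0 -> a * b = 0) ->
  fmor (cmap X f) e = idm (cmap X f x) -> is_iso e.
Proof.
move=> fs sq0 e1.
have [P [p1 [p2 [fp p1s]]]] := fibre_product_exists fs fs.
have fps : surjective (chom_comp f p1).
  by move=> y; have [b <-] := fs y; have [z <-] := p1s b; exists z.
(* P3 is the triple fibre product, with coordinates c1, c2, c3 *)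
have [P3 [q [c3 [fp3 _]]]] := fibre_product_exists fps fs.
pose c1 := chom_comp p1 q; pose c2 := chom_comp p2 q.
have med (u1 u2 u3 : chom P A) : (forall z, f (u1 z) = f (u2 z)) ->
    (forall z, f (u1 z) = f (u3 z)) ->
  exists d : chom P P3, [/\ chom_comp c1 d = u1, chom_comp c2 d = u2 & chom_comp c3 d = u3].
  move=> e12 e13; have [v [v1 v2]] := fibre_product_mediate fp e12.
  have e13' z : chom_comp f p1 (v z) = f (u3 z) := etrans (congr1 f (v1 z)) (e13 z).
  have [d [d1 d2]] := fibre_product_mediate fp3 e13'.
  exists d; split; apply: chom_ext => z; last exact: d2.
  - exact: etrans (congr1 p1 (d1 z)) (v1 z).
  - exact: etrans (congr1 p2 (d1 z)) (v2 z).
have ep z : f (p1 z) = f (p2 z) := fp.1 z.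
(* The pair w = (1, e) over P is pushed along three maps P -> P3 that repeat its
   entries, giving the triples (1, e, 1), (e, 1, 1) and (e, e, 1). *)
have [dA [dA1 dA2 dA3]] : exists d : chom P P3,
  [/\ chom_comp c1 d = p1, chom_comp c2 d = p2 & chom_comp c3 d = p1] by apply: med.
have [dB [dB1 dB2 dB3]] : exists d : chom P P3,
  [/\ chom_comp c1 d = p2, chom_comp c2 d = p1 & chom_comp c3 d = p1] by apply: med.
have [dC [dC1 dC2 dC3]] : exists d : chom P P3,
  [/\ chom_comp c1 d = p2, chom_comp c2 d = p2 & chom_comp c3 d = p1] by apply: med.
have h12 z : f (c1 z) = f (c2 z) by exact: ep.
have h23 z : f (c2 z) = f (c3 z) by rewrite -h12; exact: fp3.1.
have ms z : malcev h12 h23 sq0 (astr P3 z) = astr A z.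
  by rewrite malcevE (chom_str c1) (chom_str c2) (chom_str c3) subrr add0r.
pose m : chom P3 A := CHom ms.
have mE d z :
    chom_comp m d z = chom_comp c1 d z - chom_comp c2 d z + chom_comp c3 d z.
  exact: malcevE.
have mB : chom_comp m dB = p2 by apply: chom_ext => z; rewrite mE dB1 dB2 dB3 subrK.
have mC : chom_comp m dC = p1 by apply: chom_ext => z; rewrite mE dC1 dC2 dC3 subrr add0r.
pose i := Arr (idm x); pose a := Arr e.
have [w [[w1 w2] _]] : exists! w : Mor X P, smap p1 w = i /\ smap p2 w = a.
  apply: X_hom fs fp _ _ _.
  by rewrite /= /i amap_idm /a /amap /= e1.
rewrite /= in w w1 w2.
(* the three coordinates are jointly injective on Mor X *)
have inj3 (u v : Mor X P3) : amap (cmap X c1) u = amap (cmap X c1) v ->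
    amap (cmap X c2) u = amap (cmap X c2) v ->
    amap (cmap X c3) u = amap (cmap X c3) v -> u = v.
  rewrite !cmap_comp => e_1 e_2 e_3; apply: (homogeneous_inj fp3 X_hom fps) => //.
  exact: (homogeneous_inj fp X_hom fs).
have ww : tgt w = src w.
  apply: (mor_ob_inj fp fs); rewrite -src_amap -tgt_amap.
  - by rewrite w1.
  - by rewrite w2.
have sw1 : cmap X p1 (src w) = x by rewrite -src_amap w1.
have sw2 : cmap X p2 (src w) = x by rewrite -src_amap w2.
have inj3ob (u v : X P3) : cmap X c1 u = cmap X c1 v ->
    cmap X c2 u = cmap X c2 v -> cmap X c3 u = cmap X c3 v -> u = v.
  move=> e_1 e_2 e_3; apply: (congr1 (@src _) (x := Arr (idm u)) (y := Arr (idm v))).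
  by apply: inj3; rewrite !amap_idm (e_1, e_2, e_3).
have obAB : cmap X dA (src w) = cmap X dB (src w).
  by apply: inj3ob; rewrite -!cmap_comp_ob (dA1, dA2, dA3) (dB1, dB2, dB3) ?sw1 ?sw2.
pose u := amap (cmap X dA) w; pose v := amap (cmap X dB) w; pose t := amap (cmap X dC) w.
have comp_i b : src b = x -> tgt b = x -> (b \oa i = b) * (i \oa b = b).
  by move=> sb tb; rewrite acompa1 ?acomp1a.
have uv : tgt v = src u by rewrite /= ww obAB.
have vu : tgt u = src v by rewrite /= ww obAB.
have uvt : u \oa v = t.
  apply: inj3; rewrite amap_acomp // -!cmap_comp
    (dA1, dA2, dA3) (dB1, dB2, dB3) (dC1, dC2, dC3).
  - by rewrite w1 w2 comp_i.
  - by rewrite w1 w2 comp_i.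
  - by rewrite w1 comp_i.
have vut : v \oa u = t.
  apply: inj3; rewrite amap_acomp // -!cmap_comp
    (dA1, dA2, dA3) (dB1, dB2, dB3) (dC1, dC2, dC3).
  - by rewrite w1 w2 comp_i.
  - by rewrite w1 w2 comp_i.
  - by rewrite w1 comp_i.
have mv : amap (cmap X m) v = a by rewrite -cmap_comp mB.
have mt : amap (cmap X m) t = i by rewrite -cmap_comp mC.
apply/(arr_isoP a); exists (amap (cmap X m) u); split.
- by rewrite src_amap -uv -tgt_amap mv.
- by rewrite tgt_amap vu -src_amap mv.
- by rewrite -mv -amap_acomp // uvt mt mv.
- by rewrite -mv -amap_acomp // vut mt mv.
Qed.

Hypothesis X_full : forall (A A' : artalg L) (f : chom A A'), surjective f -> full (cmap X f).

Lemma square_zero_reflects_iso (A A' : artalg L) (f : chom A A') (x y : X A) (h : hom x y) :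
  surjective f -> (forall a b, f a = 0 -> f b = 0 -> a * b = 0) ->
  is_iso (fmor (cmap X f) h) -> is_iso h.
Proof.
move=> fs sq0 [g [gh hg]]; have [g' g'E] := X_full fs g.
apply: (@iso_of_inverses _ _ _ h g' g'); apply: (square_zero_unipotent fs sq0);
  by rewrite fmor_comp g'E.
Qed.

Lemma to_k_surj (A : artalg L) : surjective (to_k A).
Proof.
by move=> y; have [x <-] := qproj_surj y; exists (astr A x); exact: ares_str.
Qed.

Lemma arr_iso_amap_to_k (A A' : artalg L) (f : chom A A') x y (h : hom x y) :
  is_iso (fmor (cmap X (to_k A)) h) -> is_iso (fmor (cmap X (to_k A')) (fmor (cmap X f) h)).
Proof.
move=> hi; rewrite -[is_iso _]/(arr_iso (amap (cmap X (to_k A')) (amap (cmap X f) (Arr h)))).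
by rewrite amap_to_k.
Qed.

(** Induction on n: if m^n = 0 and n > 1, the kernel of A -> A / m^(n-1) squares
    to zero; if n = 1, the map to the residue field has kernel zero. *)
Lemma nilpotent_reflects_iso n (A : artalg L) (x y : X A) (h : hom x y) :
  ideal_pow [set a | ares A a = 0] n `<=` [set 0] ->
  is_iso (fmor (cmap X (to_k A)) h) -> is_iso h.
Proof.
have mI (R : artalg L) : is_ideal [set a | ares R a = 0] by case: (alocal R) => -[].
elim: n A x y h => [|[|n] IH] A x y h An hi.
- by have /eqP := An 1 Logic.I; rewrite oner_eq0.
- apply: (square_zero_reflects_iso (@to_k_surj A)) hi => a b a0 _.
  by rewrite [a]An ?mul0r //; exact: ideal_pow1.
set m := [set a | ares A a = 0] in An.
have m1 : ~ ideal_pow m n.+1 1.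
  by move=> /(ideal_pow_self (mI A)); case: (alocal A) => -[].
pose I := PIdeal (ideal_powP m n.+1) m1.
have Im : I `<=` m := @ideal_pow_self _ _ n (mI A).
pose f := aquot_hom Im.
have fs : surjective f := @qproj_surj _ I.
have f0 a : f a = 0 <-> ideal_pow m n.+1 a := qproj_eq0 I a.
apply: (square_zero_reflects_iso fs).
  move=> a b /f0 Ia /f0 Ib; apply: An => J JI; apply; exists a, b; split=> //.
  exact: (Im a Ia).
apply: IH; last exact: arr_iso_amap_to_k.
apply: subset_trans (ideal_pow_image (I := m) fs _) _.
  by move=> a; rewrite /mkset (chom_res f); exact.
by move=> _ [a Ia <-]; apply/(f0 a).
Qed.

(** Applied to lifts of isomorphisms, to elements of E^0, and to the images under
    U of morphisms of deformations. *)
Lemma to_k_reflects_iso (A : artalg L) (x y : X A) (h : hom x y) :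
  is_iso (fmor (cmap X (to_k A)) h) -> is_iso h.
Proof.
have [n An] := artinian_nilpotent (@aartinian L A) (alocal A).
exact: nilpotent_reflects_iso An.
Qed.
End Lifting.

(** * Simplicial identities of a monad *)

Section MonadArrows.
Variables (C D : category) (U : functor D C) (F : functor C D) (adj : adjunction U F) (x : C).
Local Notation T := (top U F).
Local Notation Ti n a := (iter n (amap T) a).

(** top^p (mu at top^q x) and top^p (eta at top^q x).  Every coface and codegeneracy
    is precomposition with such an arrow. *)
Definition mult_at p q : arr C := Ti p (Arr (mult adj (iter q T x))).
Definition unit_at p q : arr C := Ti p (Arr (adj_unit adj (iter q T x))).

Lemma src_mult_at p q : src (mult_at p q) = iter (p + q).+2 T x.
Proof. by rewrite src_iter -!addnS iterD. Qed.
Lemma tgt_mult_at p q : tgt (mult_at p q) = iter (p + q).+1 T x.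
Proof. by rewrite tgt_iter -!addnS iterD. Qed.
Lemma src_unit_at p q : src (unit_at p q) = iter (p + q) T x.
Proof. by rewrite src_iter iterD. Qed.
Lemma tgt_unit_at p q : tgt (unit_at p q) = iter (p + q).+1 T x.
Proof. by rewrite tgt_iter -!addnS iterD. Qed.

Lemma iter_mult_at n p q : Ti n (mult_at p q) = mult_at (n + p) q.
Proof. by rewrite /mult_at iterD. Qed.
Lemma iter_unit_at n p q : Ti n (unit_at p q) = unit_at (n + p) q.
Proof. by rewrite /unit_at iterD. Qed.

Lemma mult_at_nat p q s a : src a = iter s T x -> tgt a = iter q T x ->
  mult_at p q \oa Ti p.+2 a = Ti p.+1 a \oa mult_at p s.
Proof.
move=> sa ta; rewrite /mult_at.
have := mult_anat adj a; rewrite sa ta => /(congr1 (fun b => Ti p b)).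
by rewrite !iter_acomp ?src_amap ?tgt_amap ?sa ?ta //= -!iterSr.
Qed.

Lemma unit_at_nat p q s a : src a = iter s T x -> tgt a = iter q T x ->
  unit_at p q \oa Ti p a = Ti p.+1 a \oa unit_at p s.
Proof.
move=> sa ta; rewrite /unit_at.
have := unit_anat adj a; rewrite sa ta => /(congr1 (fun b => Ti p b)).
by rewrite !iter_acomp ?src_amap ?tgt_amap ?sa ?ta //= -!iterSr.
Qed.

Lemma mult_assoc y :
  Arr (mult adj y) \oa amap T (Arr (mult adj y)) = Arr (mult adj y) \oa Arr (mult adj (T y)).
Proof. by rewrite /amap /= !acompE /mult -!fmor_comp counit_nat. Qed.

Lemma mult_unitl y : Arr (mult adj y) \oa Arr (adj_unit adj (T y)) = Arr (idm (T y)).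
Proof. by rewrite acompE; exact: (congr1 (@Arr _ _ _) (triangleU adj (F y))). Qed.

Lemma mult_unitr y : Arr (mult adj y) \oa amap T (Arr (adj_unit adj y)) = Arr (idm (T y)).
Proof. by rewrite /amap /= acompE /mult -fmor_comp triangleF fmor_id. Qed.

(** Two multiplications at distance at least two commute by naturality; adjacent
    ones satisfy associativity. *)
Lemma mult_mult_at p q p' s : (p < p')%N -> (p + q).+1 = (p' + s)%N ->
  mult_at p q \oa mult_at p' s = mult_at p'.-1 s \oa mult_at p q.+1.
Proof.
move=> /subnKC <-; move: (p' - p.+1)%N => r e.
have -> : q = (r + s)%N by lia.
case: r {e} => [|r]; last first.
  have := @mult_at_nat p (r + s).+1 (r + s).+2 (mult_at r s)
    (src_mult_at _ _) (tgt_mult_at _ _).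
  by rewrite !iter_mult_at !addSn !addnS.
rewrite addn0 add0n; have := congr1 (fun b => Ti p b) (mult_assoc (iter s T x)).
by rewrite !iter_acomp //= -iterSr.
Qed.

Lemma unit_unit_at p q p' s : (p <= p')%N -> (p + q)%N = (p' + s).+1 ->
  unit_at p q \oa unit_at p' s = unit_at p'.+1 s \oa unit_at p q.-1.
Proof.
move=> /subnKC <-; move: (p' - p)%N => r e.
have -> : q = (r + s).+1 by lia.
have := @unit_at_nat p (r + s).+1 (r + s) (unit_at r s) (src_unit_at _ _) (tgt_unit_at _ _).
by rewrite !iter_unit_at !addSn.
Qed.

Lemma mult_unit_at_lt p q p' s : (p.+1 < p')%N -> (p + q).+1 = (p' + s)%N ->
  mult_at p q \oa unit_at p' s = unit_at p'.-1 s \oa mult_at p q.-1.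
Proof.
move=> /subnKC <-; move: (p' - p.+2)%N => r e.
have -> : q = (r + s).+1 by lia.
have := @mult_at_nat p (r + s).+1 (r + s) (unit_at r s) (src_unit_at _ _) (tgt_unit_at _ _).
by rewrite !iter_unit_at !addSn.
Qed.

Lemma mult_unit_at_gt p q p' s : (p' < p)%N -> (p + q).+1 = (p' + s)%N ->
  mult_at p q \oa unit_at p' s = unit_at p' s.-1 \oa mult_at p.-1 q.
Proof.
move=> /subnKC <-; move: (p - p'.+1)%N => r e.
have -> : s = (r + q).+2 by lia.
have := @unit_at_nat p' (r + q).+1 (r + q).+2 (mult_at r q)
  (src_mult_at _ _) (tgt_mult_at _ _).
by rewrite !iter_mult_at !addSn => ->.
Qed.

Lemma mult_unit_at_l p q : mult_at p q \oa unit_at p q.+1 = Arr (idm (iter (p + q).+1 T x)).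
Proof. by rewrite /mult_at /unit_at -iter_acomp // mult_unitl iter_idm -addnS iterD. Qed.

Lemma mult_unit_at_r p q : mult_at p q \oa unit_at p.+1 q = Arr (idm (iter (p + q).+1 T x)).
Proof.
by rewrite /mult_at /unit_at iterSr -iter_acomp // mult_unitr iter_idm -addnS iterD.
Qed.

(** Bookkeeping of endpoints: composability of arrows between iterates of T
    becomes an equation between natural numbers. *)
Definition degrees m n (a : arr C) : Prop := src a = iter m T x /\ tgt a = iter n T x.

Lemma degrees_mult p q : degrees (p + q).+2 (p + q).+1 (mult_at p q).
Proof. by split; [exact: src_mult_at|exact: tgt_mult_at]. Qed.

Lemma degrees_unit p q : degrees (p + q) (p + q).+1 (unit_at p q).
Proof. by split; [exact: src_unit_at|exact: tgt_unit_at]. Qed.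

Lemma degrees_iter r m n a : degrees m n a -> degrees (r + m) (r + n) (Ti r a).
Proof. by move=> [sa ta]; split; rewrite ?src_iter ?tgt_iter ?sa ?ta iterD. Qed.

Lemma acompA_degrees c b a n n' m m' l :
  src c = iter n T x -> degrees m n' b -> degrees l m' a -> n = n' -> m = m' ->
  c \oa b \oa a = c \oa (b \oa a).
Proof. by move=> sc [sb tb] [sa ta] e e'; rewrite acompA ?sc ?sb ?tb ?ta ?e ?e'. Qed.
End MonadArrows.

(** * The simplicial deformation complex of maps from iterates of the monad *)

Section HomSDC.
Variable L : complete_noetherian_local_ring.
Local Notation CL := (artalg L).
Local Notation k := (kobj L).
Variables (D B : cat_functor L) (U : cat_trans D B) (F : cat_trans B D).
Variable adj : functorial_adjunction U F.
Variables (D0 : D k) (b : lim_ob B) (alpha : hom (lim_at b k) (U k D0)).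
Local Notation T A := (top (U A) (F A)).
Local Notation Ti A n a := (iter n (amap (T A)) a).
Local Notation B_ A := (lim_at b A).
Local Notation mu A := (mult_at (adj A) (B_ A)).
Local Notation eta A := (unit_at (adj A) (B_ A)).
Local Notation E := (hom_sdc_data adj alpha).

(** Degrees that agree only propositionally are harmless, since the underlying
    arrow does not mention the degree. *)
Lemma hom_graded_eq A m n (x : E m A) (y : E n A) :
  m = n -> sval x = sval y -> graded_eq x y.
Proof. by move=> e; case: _ / e y => y /hom_set_ext ->. Qed.

Lemma face_arrE n i A g : face_arr adj b n i g = g \oa mu A i.-1 (n - i).
Proof. by []. Qed.

Lemma degen_arrE n i A g : degen_arr adj b n i g = g \oa eta A i (n - i - 1).
Proof. by []. Qed.

Section Arr.
Variables (A : CL) (n : nat) (g : arr (B A)).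
Hypothesis sg : src g = iter n (T A) (B_ A).
Local Notation face := (face_arr adj b).
Local Notation degen := (degen_arr adj b).

Lemma face_face_arr i j : (0 < i)%N -> (i < j <= n.+1)%N ->
  face n.+1 j (face n i g) = face n.+1 i (face n j.-1 g).
Proof.
move=> i0 /andP[ij jn]; rewrite !face_arrE.
rewrite (acompA_degrees sg (degrees_mult _ _ _ _) (degrees_mult _ _ _ _)); [|lia..].
rewrite (acompA_degrees sg (degrees_mult _ _ _ _) (degrees_mult _ _ _ _)); [|lia..].
rewrite mult_mult_at; [|lia..].
have -> : (n.+1 - j = n - j.-1)%N by lia.
by have -> : (n.+1 - i = (n - i).+1)%N by lia.
Qed.

Lemma degen_degen_arr i j : (i <= j)%N -> (j.+1 < n)%N ->
  degen n.-1 j (degen n i g) = degen n.-1 i (degen n j.+1 g).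
Proof.
move=> ij jn; rewrite !degen_arrE.
rewrite (acompA_degrees sg (degrees_unit _ _ _ _) (degrees_unit _ _ _ _)); [|lia..].
rewrite (acompA_degrees sg (degrees_unit _ _ _ _) (degrees_unit _ _ _ _)); [|lia..].
rewrite unit_unit_at; [|lia..].
have -> : (n.-1 - j - 1 = n - j.+1 - 1)%N by lia.
by have -> : (n.-1 - i - 1 = (n - i - 1).-1)%N by lia.
Qed.

Lemma degen_face_lt_arr i j : (0 < i < j)%N -> (j <= n)%N ->
  degen n.+1 j (face n i g) = face n.-1 i (degen n j.-1 g).
Proof.
move=> /andP[i0 ij] jn; rewrite !degen_arrE !face_arrE.
rewrite (acompA_degrees sg (degrees_mult _ _ _ _) (degrees_unit _ _ _ _)); [|lia..].
rewrite (acompA_degrees sg (degrees_unit _ _ _ _) (degrees_mult _ _ _ _)); [|lia..].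
rewrite mult_unit_at_lt; [|lia..].
have -> : (n.+1 - j - 1 = n - j.-1 - 1)%N by lia.
by have -> : (n.-1 - i = (n - i).-1)%N by lia.
Qed.

Lemma degen_face_gt_arr i j : (j.+1 < i <= n)%N ->
  degen n.+1 j (face n i g) = face n.-1 i.-1 (degen n j g).
Proof.
move=> /andP[ij jn]; rewrite !degen_arrE !face_arrE.
rewrite (acompA_degrees sg (degrees_mult _ _ _ _) (degrees_unit _ _ _ _)); [|lia..].
rewrite (acompA_degrees sg (degrees_unit _ _ _ _) (degrees_mult _ _ _ _)); [|lia..].
rewrite mult_unit_at_gt; [|lia..].
have -> : (n - j - 1 = (n.+1 - j - 1).-1)%N by lia.
by have -> : (n.-1 - i.-1 = n - i)%N by lia.
Qed.

Lemma degen_face_eq_arr i j : (0 < i <= n)%N -> i = j \/ i = j.+1 ->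
  degen n.+1 j (face n i g) = g.
Proof.
move=> /andP[i0 jn] ij; rewrite !degen_arrE !face_arrE.
rewrite (acompA_degrees sg (degrees_mult _ _ _ _) (degrees_unit _ _ _ _)); [|lia..].
case: ij => e; subst i.
  case: j i0 jn => // j _ jn /=; have -> : (n.+1 - j.+1 - 1 = n - j.+1)%N by lia.
  by rewrite mult_unit_at_r acompa1 // sg; congr (iter _ _ _); lia.
have -> : (n.+1 - j - 1 = (n - j.+1).+1)%N by lia.
by rewrite mult_unit_at_l acompa1 // sg; congr (iter _ _ _); lia.
Qed.

Variables (m : nat) (h : arr (B A)).
Hypotheses (sh : src h = iter m (T A) (B_ A)) (th : tgt h = B_ A).
Local Notation prod := (g \oa iter n (amap (T A)) h).

Let dh r : degrees (U A) (F A) (B_ A) (r + m) (r + 0) (Ti A r h).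
Proof. by apply: degrees_iter; split. Qed.

(** The face acts on the first n inputs, and top^n h on the others; they commute
    by naturality of the multiplication. *)
Lemma face_prodl_arr i : (0 < i <= n)%N ->
  face n i g \oa Ti A n.+1 h = face (n + m) i prod.
Proof.
move=> hi; rewrite !face_arrE.
rewrite (acompA_degrees sg (degrees_mult _ _ _ _) (dh _)); [|lia..].
rewrite (acompA_degrees sg (dh _) (degrees_mult _ _ _ _)); [|lia..].
have -> : Ti A n.+1 h = Ti A i.-1.+2 (Ti A (n - i) h) by rewrite -iterD; congr (Ti A _ h); lia.
rewrite (@mult_at_nat _ _ _ _ _ _ i.-1 (n - i) (n - i + m)) -?iterD.
- congr (_ \oa _); congr (Ti A _ h \oa mu A _ _); lia.
- by case: (dh (n - i)) => ->.
- by case: (dh (n - i)) => _ ->; rewrite addn0.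
Qed.

Lemma degen_prodl_arr i : (i < n)%N ->
  degen n i g \oa Ti A n.-1 h = degen (n + m) i prod.
Proof.
move=> hi; rewrite !degen_arrE.
rewrite (acompA_degrees sg (degrees_unit _ _ _ _) (dh _)); [|lia..].
rewrite (acompA_degrees sg (dh _) (degrees_unit _ _ _ _)); [|lia..].
have -> : Ti A n.-1 h = Ti A i (Ti A (n - i - 1) h) by rewrite -iterD; congr (Ti A _ h); lia.
rewrite (@unit_at_nat _ _ _ _ _ _ i (n - i - 1) (n - i - 1 + m)) -?iterD.
- congr (_ \oa _); congr (Ti A _ h \oa eta A _ _); lia.
- by case: (dh (n - i - 1)) => ->.
- by case: (dh (n - i - 1)) => _ ->; rewrite addn0.
Qed.

Lemma face_prodr_arr i : (0 < i <= m)%N ->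
  g \oa Ti A n (face m i h) = face (n + m) (i + n) prod.
Proof.
move=> /andP[i0 im]; rewrite !face_arrE iter_acomp; last first.
  by rewrite tgt_mult_at sh; congr (iter _ (T A) (B_ A)); lia.
rewrite iter_mult_at.
rewrite (acompA_degrees sg (dh _) (degrees_mult _ _ _ _)); [|lia..].
congr (_ \oa (_ \oa mu A _ _)); lia.
Qed.

Lemma degen_prodr_arr i : (i < m)%N ->
  g \oa Ti A n (degen m i h) = degen (n + m) (i + n) prod.
Proof.
move=> im; rewrite !degen_arrE iter_acomp; last first.
  by rewrite tgt_unit_at sh; congr (iter _ (T A) (B_ A)); lia.
rewrite iter_unit_at.
rewrite (acompA_degrees sg (dh _) (degrees_unit _ _ _ _)); [|lia..].
congr (_ \oa (_ \oa eta A _ _)); lia.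
Qed.
End Arr.

Lemma amap_mult_at A A' (f : chom A A') p q : amap (cmap B f) (mu A p q) = mu A' p q.
Proof. by rewrite /mult_at iter_top_base (mult_base adj) iter_top_base_ob cmap_lim_at. Qed.

Lemma amap_unit_at A A' (f : chom A A') p q : amap (cmap B f) (eta A p q) = eta A' p q.
Proof. by rewrite /unit_at iter_top_base unit_base iter_top_base_ob cmap_lim_at. Qed.

Lemma hom_src n A (e : E n A) : src (sval e) = iter n (T A) (B_ A).
Proof. by case: e => g []. Qed.

Lemma hom_tgt n A (e : E n A) : tgt (sval e) = B_ A.
Proof. by case: e => g []. Qed.

Section Identities.
Hypothesis B_hom : homogeneous (Mor B).
Hypothesis B_full : forall (A A' : CL) (f : chom A A'), surjective f -> full (cmap B f).
Hypothesis alpha_iso : is_iso alpha.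

(** Endpoints of the wanted lift are fixed, so smoothness is fullness of the base
    change functor; the condition over k is inherited. *)
Lemma hom_smooth n : smooth (E n).
Proof.
move=> A A' f fs [y [sy ty oy]].
have [] := full_lift (F := cmap B f) (b := y) (x := iter n (T A) (B_ A))
  (y := B_ A) (B_full fs).
- by rewrite sy iter_top_base_ob cmap_lim_at.
- by rewrite ty cmap_lim_at.
move=> h hE; have oh : over_beta adj alpha n (Arr h).
  by split=> //; rewrite -(amap_to_k f) hE.
by exists (exist _ _ oh); apply: hom_set_ext.
Qed.

(** Homogeneity of Mor B glues the arrows; the glued arrow has the right endpoints
    because objects over a fibre product are separated by the two projections. *)
Lemma hom_homogeneous n : homogeneous (E n).
Proof.
move=> A A1 A2 P f g p q fs fp u v uv.
have uv' : smap (s := Mor B) f (sval u) = smap (s := Mor B) g (sval v).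
  exact: (congr1 sval (uv : hom_map f u = hom_map g v)).
have [w [[w1 w2] wu]] := B_hom fs fp uv'.
rewrite /= in w1 w2.
have ow : over_beta adj alpha n w.
  split.
  - apply: (mor_ob_inj B_hom fp fs);
      by rewrite -src_amap (w1, w2) hom_src iter_top_base_ob cmap_lim_at.
  - apply: (mor_ob_inj B_hom fp fs);
      by rewrite -tgt_amap (w1, w2) hom_tgt cmap_lim_at.
  - by rewrite -(amap_to_k p) w1; case: (svalP u).
exists (exist _ _ ow); split; first by split; apply: hom_set_ext.
move=> [w' ow'] [e1 e2]; apply: hom_set_ext; apply: wu.
split; first exact: (congr1 sval (e1 : hom_map p _ = u)).
exact: (congr1 sval (e2 : hom_map q _ = v)).
Qed.

Lemma amap_to_kk (a : arr (B k)) : amap (cmap B (to_k k)) a = a.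
Proof. by rewrite -(to_k_uniq (chom_id k)) cmap_id. Qed.

(** Over k an element is determined by alpha o x = beta o top^n alpha, as alpha is
    invertible. *)
Lemma hom_point n : exists x : E n k, forall y, y = x.
Proof.
have [alphai [a1 a2]] := alpha_iso.
have l1 : Arr alphai \oa Arr alpha = Arr (idm (B_ k)) by rewrite acompE a1.
have l2 : Arr alpha \oa Arr alphai = Arr (idm (U k D0)) by rewrite acompE a2.
pose b0 := hom_beta adj D0 n \oa Ti k n (Arr alpha).
have bT : tgt (Ti k n (Arr alpha)) = src (hom_beta adj D0 n) by rewrite tgt_iter src_beta.
have sb0 : src b0 = iter n (T k) (B_ k) by rewrite src_acomp // src_iter.
have tb0 : tgt b0 = U k D0 by rewrite tgt_acomp.
have ox : over_beta adj alpha n (Arr alphai \oa b0).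
  split; [by rewrite src_acomp|by rewrite tgt_acomp|].
  by rewrite amap_to_kk acompA // l2 acomp1a.
exists (exist _ _ ox) => -[y [sy ty oy]]; apply: hom_set_ext => /=.
by rewrite /b0 -oy amap_to_kk acompA // l1 acomp1a.
Qed.

Lemma hom_is_sdc : is_sdc E.
Proof.
split.
- exact: hom_smooth.
- exact: hom_homogeneous.
- exact: hom_point.
- move=> n i hi A A' f e; apply: hom_set_ext => /=.
  rewrite !face_arrE amap_acomp ?amap_mult_at //.
  by rewrite tgt_mult_at hom_src; congr (iter _ (T A) (B_ A)); lia.
- move=> n i hi A A' f e; apply: hom_set_ext => /=.
  rewrite !degen_arrE amap_acomp ?amap_unit_at //.
  by rewrite tgt_unit_at hom_src; congr (iter _ (T A) (B_ A)); lia.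
- move=> m n A A' f e e'; apply: hom_set_ext => /=.
  by rewrite amap_acomp ?iter_top_base // tgt_iter hom_tgt hom_src.
- by move=> A A' f; apply: hom_set_ext; rewrite /= amap_idm cmap_lim_at.
- move=> m n p A e f g; apply: hom_graded_eq => /=; first by rewrite addnA.
  rewrite iter_acomp ?tgt_iter ?hom_tgt ?hom_src // -iterD acompA //.
    by rewrite !tgt_iter src_iter hom_tgt hom_src iterD.
  by rewrite tgt_iter hom_tgt hom_src.
- by move=> n A e; apply: hom_graded_eq; rewrite //= acomp1a // hom_tgt.
- move=> n A e; apply: hom_graded_eq; rewrite /= ?addn0 // iter_idm acompa1 //.
  by rewrite hom_src.
- move=> n i j A e hi hj hj' hi' ij; apply: hom_graded_eq => //=.
  by apply: face_face_arr; [exact: hom_src|lia..].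
- move=> n i j A e hi hj hj' hi' ij; apply: hom_graded_eq => //=.
  by apply: degen_degen_arr; [exact: hom_src|lia..].
- move=> n i j A e hi hj hj' hi' ij; apply: hom_graded_eq => /=; first lia.
  by apply: degen_face_lt_arr; [exact: hom_src|lia..].
- move=> n i j A e hi hj ij; apply: hom_graded_eq => //=.
  by apply: degen_face_eq_arr; [exact: hom_src|lia..].
- move=> n i j A e hi hj hj' hi' ij; apply: hom_graded_eq => /=; first lia.
  by apply: degen_face_gt_arr; [exact: hom_src|lia..].
- move=> m n i A e f hi hi'; apply: hom_graded_eq => //=.
  by apply: face_prodl_arr; [exact: hom_src|exact: hom_src|exact: hom_tgt|].
- move=> m n i A e f hi hi'; apply: hom_graded_eq => /=; first lia.
  by apply: face_prodr_arr; [exact: hom_src|exact: hom_src|exact: hom_tgt|].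
- move=> m n i A e f hi hi'; apply: hom_graded_eq => /=; first lia.
  by apply: degen_prodl_arr; [exact: hom_src|exact: hom_src|exact: hom_tgt|].
- move=> m n i A e f hi hi'; apply: hom_graded_eq => /=; first lia.
  by apply: degen_prodr_arr; [exact: hom_src|exact: hom_src|exact: hom_tgt|].
Qed.
End Identities.
End HomSDC.

(** * Inverses of arrows *)

(** The inverse with endpoints known only propositionally; arrows without an
    inverse are sent to themselves. *)
Definition ainv (C : category) (a : arr C) : arr C :=
  if pselect (arr_iso a) is left h then Arr (sval (cid h)) else a.

Lemma ainv_Arr (C : category) (x y : C) (f : hom x y) (g : hom y x) :
  g \oc f = idm x -> f \oc g = idm y -> ainv (Arr f) = Arr g.
Proof.
move=> gf fg; rewrite /ainv; case: pselect => [h|[]]; last by exists g.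
case: (cid h) => g' /= [g'f fg']; congr Arr.
by rewrite -[g']compm1 -fg compA g'f comp1m.
Qed.

Section Ainv.
Variable C : category.
Implicit Types (a b c : arr C) (x y : C).

Lemma arr_isoE a x y : arr_iso a -> src a = x -> tgt a = y ->
  exists (f : hom x y) (g : hom y x), [/\ a = Arr f, ainv a = Arr g,
    g \oc f = idm x & f \oc g = idm y].
Proof.
case: a => x' y' f /= [g [gf fg]] <- <-; exists f, g; split=> //.
exact: ainv_Arr.
Qed.

Lemma src_ainv a : arr_iso a -> src (ainv a) = tgt a.
Proof. by case: a => x y f [g [gf fg]]; rewrite (ainv_Arr gf fg). Qed.

Lemma tgt_ainv a : arr_iso a -> tgt (ainv a) = src a.
Proof. by case: a => x y f [g [gf fg]]; rewrite (ainv_Arr gf fg). Qed.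

Lemma ainv_l a x : arr_iso a -> src a = x -> ainv a \oa a = Arr (idm x).
Proof. by case: a => x' y f [g [gf fg]] /= <-; rewrite (ainv_Arr gf fg) acompE gf. Qed.

Lemma ainv_r a y : arr_iso a -> tgt a = y -> a \oa ainv a = Arr (idm y).
Proof. by case: a => x y' f [g [gf fg]] /= <-; rewrite (ainv_Arr gf fg) acompE fg. Qed.

Lemma arr_iso_ainv a : arr_iso a -> arr_iso (ainv a).
Proof. by case: a => x y f [g [gf fg]]; rewrite (ainv_Arr gf fg); exists f. Qed.

Lemma arr_iso_amap (C' : category) (F : functor C C') a : arr_iso a -> arr_iso (amap F a).
Proof. exact: iso_amap. Qed.

Lemma amap_ainv (C' : category) (F : functor C C') a :
  arr_iso a -> amap F (ainv a) = ainv (amap F a).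
Proof.
case: a => x y f [g [gf fg]]; rewrite (ainv_Arr gf fg).
by rewrite /amap /= (@ainv_Arr _ _ _ (fmor F f) (fmor F g)) // -fmor_comp ?gf ?fg fmor_id.
Qed.

Lemma arr_iso_acomp b a : tgt a = src b -> arr_iso b -> arr_iso a -> arr_iso (b \oa a).
Proof.
case: a b => x y f [y' z g] /= e; case: _ / e g => g hg hf; rewrite acompE.
exact: iso_comp.
Qed.

Lemma acompKl b a : arr_iso b -> tgt a = src b -> ainv b \oa (b \oa a) = a.
Proof. by move=> hb e; rewrite acompA ?src_ainv // (ainv_l hb (esym e)) acomp1a. Qed.

Lemma acomp_injl b a a' : arr_iso b -> tgt a = src b -> tgt a' = src b ->
  b \oa a = b \oa a' -> a = a'.
Proof. by move=> hb e e' /(congr1 (acomp (ainv b))); rewrite !acompKl. Qed.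

Lemma arr_iso_cancel b a : tgt a = src b -> arr_iso b -> arr_iso (b \oa a) -> arr_iso a.
Proof.
move=> e hb hba; rewrite -(acompKl hb e).
by apply: arr_iso_acomp => //; rewrite ?tgt_acomp ?src_ainv //; exact: arr_iso_ainv.
Qed.
End Ainv.

(** * Consequences of monadicity *)

Section Monadic.
Variables (C D : category) (U : functor D C) (F : functor C D) (adj : adjunction U F).
Hypothesis mon : monadic adj.

Lemma monadic_faithful : faithful U.
Proof.
move=> x y f g fg; case: mon => _ fa _; apply: fa.
exact: alg_hom_ext.
Qed.

Lemma monadic_full x y (h : hom (U x) (U y)) :
  h \oc fmor U (adj_counit adj x) = fmor U (adj_counit adj y) \oc fmor (top U F) h ->
  exists f : hom x y, fmor U f = h.
Proof.
move=> hh; case: mon => fu _ _.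
have [f fE] := fu x y (exist _ h hh : hom (comparison adj x) (comparison adj y)).
by exists f; exact: (congr1 sval fE).
Qed.

(** The inverse of an algebra morphism is an algebra morphism. *)
Lemma monadic_reflects_iso x y (f : hom x y) : is_iso (fmor U f) -> is_iso f.
Proof.
move=> [g [gf fg]].
have [|g' g'E] := @monadic_full y x g.
  have e : fmor (top U F) (fmor U f) \oc fmor (top U F) g = idm _.
    by rewrite -fmor_comp fg fmor_id.
  have n : fmor U f \oc fmor U (adj_counit adj x)
      = fmor U (adj_counit adj y) \oc fmor (top U F) (fmor U f).
    by rewrite /= -!fmor_comp counit_nat.
  rewrite -[LHS]compm1 -e -!compA (compA (fmor U (adj_counit adj y))) -n.
  by rewrite !compA gf comp1m.
by exists g'; split; apply: monadic_faithful; rewrite fmor_comp g'E ?gf ?fg fmor_id.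
Qed.

Lemma monadic_algebra z (w : hom (top U F z) z) :
  w \oc adj_unit adj z = idm z -> w \oc fmor (top U F) w = w \oc mult adj z ->
  exists x (t : hom (U x) z), is_iso t /\
    t \oc fmor U (adj_counit adj x) = w \oc fmor (top U F) t.
Proof.
move=> w1 w2; case: mon => _ _ /(_ (Algebra w1 w2))[x [[t tE] [[s sE] [st ts]]]].
exists x, t; split=> //; exists s.
by split; [exact: (congr1 sval st)|exact: (congr1 sval ts)].
Qed.

Lemma amap_monadic_inj (a b : arr D) : src a = src b -> tgt a = tgt b ->
  amap U a = amap U b -> a = b.
Proof.
case: a b => x y f [x' y' g] /= e1 e2; case: _ / e1 g; case: _ / e2 => g /Arr_inj fg.
by congr Arr; exact: monadic_faithful.
Qed.
End Monadic.

(** * Algebra structures carried to the fixed object *)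

Lemma amap_Arr (C C' : category) (F : functor C C') (x y : C) (f : hom x y) :
  amap F (Arr f) = Arr (fmor F f).
Proof. by []. Qed.

Section Framings.
Variable L : complete_noetherian_local_ring.
Local Notation CL := (artalg L).
Local Notation k := (kobj L).
Variables (D B : cat_functor L) (U : cat_trans D B) (F : cat_trans B D).
Variable adj : functorial_adjunction U F.
Variables (D0 : D k) (b : lim_ob B) (alpha : hom (lim_at b k) (U k D0)).
Local Notation T A := (top (U A) (F A)).
Local Notation B_ A := (lim_at b A).
Local Notation E := (hom_sdc_data adj alpha).
Local Notation redk A := (amap (cmap B (to_k A))).
Local Notation Ueps A x := (amap (U A) (Arr (adj_counit (adj A) x))).

(** An identification t of the underlying object of x with the fixed object B(A).
    The endpoints are propositional so that framings can be pushed forward along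
    base change. *)
Definition framed A (x : D A) (t : arr (B A)) : Prop :=
  [/\ src t = U A x, tgt t = B_ A & arr_iso t].

(** The structure map U eps_x of the algebra of x, carried to B(A) along t. *)
Definition carried_action A (x : D A) (t : arr (B A)) : arr (B A) :=
  t \oa (Ueps A x \oa amap (T A) (ainv t)).

(** The matrix of U f in the framings t and s. *)
Definition transport A (f : arr (D A)) (t s : arr (B A)) : arr (B A) :=
  s \oa (amap (U A) f \oa ainv t).

Section Fixed.
Variable A : CL.
Implicit Types (x y z : D A) (t s u : arr (B A)).

Lemma framedE x t : framed x t ->
  exists (t' : hom (U A x) (B_ A)) (ti : hom (B_ A) (U A x)),
    [/\ t = Arr t', ainv t = Arr ti, ti \oc t' = idm _ & t' \oc ti = idm _].
Proof. by move=> [st tt it]; exact: arr_isoE. Qed.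

Lemma carriedE x (t : hom (U A x) (B_ A)) (ti : hom (B_ A) (U A x)) :
  ainv (Arr t) = Arr ti ->
  carried_action x (Arr t) = Arr (t \oc (fmor (U A) (adj_counit (adj A) x) \oc fmor (T A) ti)).
Proof. by move=> e; rewrite /carried_action e /amap /= !acompE. Qed.

Lemma transportE x y (f : hom x y) (t : hom (U A x) (B_ A))
    (ti : hom (B_ A) (U A x)) (s : hom (U A y) (B_ A)) :
  ainv (Arr t) = Arr ti ->
  transport (Arr f) (Arr t) (Arr s) = Arr (s \oc (fmor (U A) f \oc ti)).
Proof. by move=> e; rewrite /transport e /amap /= !acompE. Qed.

Lemma transport_id x t : framed x t -> transport (Arr (idm x)) t t = Arr (idm (B_ A)).
Proof.
move=> /framedE[t' [ti [-> tiE _ e]]].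
by rewrite (transportE _ _ tiE) fmor_id comp1m e.
Qed.

Lemma transport_comp x y z (f' : hom y z) (f : hom x y) t s u :
  framed x t -> framed y s -> framed z u ->
  transport (Arr f') s u \oa transport (Arr f) t s = transport (Arr (f' \oc f)) t u.
Proof.
move=> /framedE[t' [ti [-> tiE _ _]]] /framedE[s' [si [-> siE e _]]].
move=> /framedE[u' [ui [-> _ _ _]]].
rewrite (transportE _ _ tiE) (transportE _ _ siE) (transportE _ _ tiE) acompE fmor_comp.
by rewrite -!compA (compA si) e comp1m.
Qed.

(** This is the gauge relation: U f is a morphism of algebras. *)
Lemma transport_carried x y (f : hom x y) t s : framed x t -> framed y s ->
  transport (Arr f) t s \oa carried_action x t
  = carried_action y s \oa amap (T A) (transport (Arr f) t s).
Proof.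
move=> /framedE[t' [ti [-> tiE e _]]] /framedE[s' [si [-> siE e' _]]].
rewrite (transportE _ _ tiE) (carriedE tiE) (carriedE siE) amap_Arr !acompE; congr Arr.
rewrite 2!fmor_comp -!compA (compA ti) e comp1m; congr (_ \oc _).
rewrite (compA (fmor (T A) si)) -(fmor_comp (T A)) e' fmor_id comp1m !compA; congr (_ \oc _).
by rewrite /= -!fmor_comp counit_nat.
Qed.

(** Associativity of the algebra U eps_x, in the form of the Maurer-Cartan
    equation. *)
Lemma carried_assoc x t : framed x t ->
  carried_action x t \oa amap (T A) (carried_action x t)
  = carried_action x t \oa Arr (mult (adj A) (B_ A)).
Proof.
move=> /framedE[t' [ti [-> tiE e _]]].
rewrite (carriedE tiE) amap_Arr !acompE; congr Arr.
set c := adj_counit (adj A) x.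
rewrite 2!fmor_comp -!compA; congr (_ \oc _).
rewrite (compA (fmor (T A) ti)) -(fmor_comp (T A)) e fmor_id comp1m.
rewrite compA /= /mult -!fmor_comp; congr (fmor (U A) _).
by rewrite /c counit_nat.
Qed.

Lemma src_carried x t : framed x t -> src (carried_action x t) = T A (B_ A).
Proof. by move=> /framedE[t' [ti [-> tiE _ _]]]; rewrite (carriedE tiE). Qed.

Lemma tgt_carried x t : framed x t -> tgt (carried_action x t) = B_ A.
Proof. by move=> /framedE[t' [ti [-> tiE _ _]]]; rewrite (carriedE tiE). Qed.

Lemma src_transport x y (f : hom x y) t s : framed x t -> framed y s ->
  src (transport (Arr f) t s) = B_ A.
Proof.
move=> /framedE[t' [ti [-> tiE _ _]]] /framedE[s' [si [-> _ _ _]]].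
by rewrite (transportE _ _ tiE).
Qed.

Lemma tgt_transport x y (f : hom x y) t s : framed x t -> framed y s ->
  tgt (transport (Arr f) t s) = B_ A.
Proof.
move=> /framedE[t' [ti [-> tiE _ _]]] /framedE[s' [si [-> _ _ _]]].
by rewrite (transportE _ _ tiE).
Qed.

Lemma carried_uniq x (t : hom (U A x) (B_ A)) (w : hom (T A (B_ A)) (B_ A)) :
  is_iso t -> t \oc fmor (U A) (adj_counit (adj A) x) = w \oc fmor (T A) t ->
  carried_action x (Arr t) = Arr w.
Proof.
move=> [ti [e e']] tw; rewrite (carriedE (ainv_Arr e e')) compA tw -compA.
by rewrite -(fmor_comp (T A)) e' fmor_id compm1.
Qed.
End Fixed.

Lemma framed_map A A' (r : chom A A') (x : D A) t : framed x t ->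
  framed (cmap D r x) (amap (cmap B r) t).
Proof.
move=> [st tt it]; split; last exact: arr_iso_amap.
  by rewrite src_amap st ctrans_nat_ob.
by rewrite tgt_amap tt cmap_lim_at.
Qed.

Lemma carried_map A A' (r : chom A A') (x : D A) t : framed x t ->
  amap (cmap B r) (carried_action x t) = carried_action (cmap D r x) (amap (cmap B r) t).
Proof.
move=> [st tt it]; have e : tgt (amap (T A) (ainv t)) = src (Ueps A x).
  by rewrite tgt_amap tgt_ainv // st.
rewrite /carried_action !amap_acomp ?tgt_acomp // top_base amap_ainv //.
by rewrite -ctrans_nat counit_base.
Qed.

Lemma transport_map A A' (r : chom A A') (x y : D A) (f : hom x y) t s :
  framed x t -> framed y s ->
  amap (cmap B r) (transport (Arr f) t s)
  = transport (amap (cmap D r) (Arr f)) (amap (cmap B r) t) (amap (cmap B r) s).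
Proof.
move=> [st tt it] [ss ts _]; have e : tgt (ainv t) = src (amap (U A) (Arr f)).
  by rewrite tgt_ainv // st.
by rewrite /transport !amap_acomp ?tgt_acomp // amap_ainv // -ctrans_nat.
Qed.

Hypothesis B_hom : homogeneous (Mor B).
Hypothesis B_full : forall (A A' : CL) (f : chom A A'), surjective f -> full (cmap B f).
Hypothesis alpha_iso : is_iso alpha.
Hypothesis adj_monadic : forall A : CL, monadic (adj A).

Let alpha_iso' : arr_iso (Arr alpha) := alpha_iso.

Lemma arr_to_k_reflects_iso A (a : arr (B A)) : arr_iso (redk A a) -> arr_iso a.
Proof. exact: to_k_reflects_iso. Qed.

Lemma over_beta0P A (a : arr (B A)) : over_beta adj alpha 0 a <->
  [/\ src a = B_ A, tgt a = B_ A & Arr alpha \oa redk A a = Arr alpha].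
Proof.
have e : hom_beta adj D0 0 \oa iter 0 (amap (T k)) (Arr alpha) = Arr alpha.
  by rewrite /hom_beta /= amap_idm acomp1a.
by rewrite /over_beta e.
Qed.

(** A framing of the underlying object that restricts over k to the given
    identifications with U D0. *)
Definition framing A (X : def_ob D0 A) (t : arr (B A)) : Prop :=
  framed (dob X) t /\ Arr alpha \oa redk A t = amap (U k) (dphi X).

(** The isomorphism alpha^-1 o U phi over k lifts by fullness, and its lift is an
    isomorphism. *)
Lemma framing_exists A (X : def_ob D0 A) : exists t, framing X t.
Proof.
have ia := src_ainv alpha_iso'; have ta := tgt_ainv alpha_iso'.
pose c := ainv (Arr alpha) \oa amap (U k) (dphi X).
have cs : tgt (amap (U k) (dphi X)) = src (ainv (Arr alpha)) by rewrite ia tgt_amap dphi_tgt.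
have [] := full_lift (b := c) (x := U A (dob X)) (y := B_ A) (B_full (@to_k_surj _ A)).
- by rewrite src_acomp // src_amap dphi_src ctrans_nat_ob.
- by rewrite tgt_acomp // ta /= cmap_lim_at.
move=> h hc; exists (Arr h); split; first split=> //.
  apply: arr_to_k_reflects_iso; rewrite hc.
  apply: arr_iso_acomp => //; first exact: arr_iso_ainv.
  exact/arr_iso_amap/dphi_iso.
by rewrite hc acompA // (ainv_r alpha_iso' erefl) acomp1a // tgt_amap dphi_tgt.
Qed.

Lemma framing_map A A' (r : chom A A') (X : def_ob D0 A) t : framing X t ->
  framing (def_map_ob r X) (amap (cmap B r) t).
Proof.
by move=> [ft ot]; split; [exact: framed_map|rewrite amap_to_k].
Qed.

Lemma framing_redE A (X : def_ob D0 A) t : framing X t ->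
  exists (p : hom (cmap D (to_k A) (dob X)) D0)
         (u : hom (U k (cmap D (to_k A) (dob X))) (B_ k)) ui,
    [/\ dphi X = Arr p, redk A t = Arr u, ainv (Arr u) = Arr ui, u \oc ui = idm (B_ k)
      & alpha \oc u = fmor (U k) p].
Proof.
move=> [ft ot]; have [p pE] := arrP (dphi_src X) (dphi_tgt X).
have [u [ui [uE uiE _ e]]] := framedE (framed_map (to_k A) ft).
exists p, u, ui; rewrite -uE; split=> //.
by apply: Arr_inj; rewrite -acompE -uE ot pE.
Qed.

Lemma carried_over A (X : def_ob D0 A) t : framing X t ->
  over_beta adj alpha 1 (carried_action (dob X) t).
Proof.
move=> ft; split; [exact: src_carried ft.1|exact: tgt_carried ft.1|].
rewrite (carried_map _ ft.1); have [p [u [ui [_ -> uiE e ou]]]] := framing_redE ft.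
rewrite (carriedE uiE) /hom_beta /= comp1m !amap_Arr !acompE; congr Arr.
rewrite compA ou compA -fmor_comp -counit_nat fmor_comp -compA; congr (_ \oc _).
rewrite -ou -[fmor (U k) (fmor (F k) _) in LHS]/(fmor (T k) _) -(fmor_comp (T k)).
by rewrite -compA e compm1.
Qed.

Lemma transport_over A (X Y : def_ob D0 A) (f : def_hom X Y) t s :
  framing X t -> framing Y s ->
  over_beta adj alpha 0 (transport (Arr (sval f)) t s).
Proof.
move=> ft fs; apply/over_beta0P; split;
  [exact: src_transport ft.1 fs.1|exact: tgt_transport ft.1 fs.1|].
rewrite (transport_map _ _ ft.1 fs.1).
have [p [u [ui [pE -> uiE e ou]]]] := framing_redE ft.
have [q [v [vi [qE -> _ _ ov]]]] := framing_redE fs.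
case: f => f /=; rewrite pE qE amap_Arr acompE => /Arr_inj qf.
rewrite (transportE _ _ uiE) acompE; congr Arr.
by rewrite compA ov compA -fmor_comp qf -ou -compA e compm1.
Qed.

Lemma carried_mc A (X : def_ob D0 A) t (ft : framing X t) :
  let w : E 1 A := exist _ _ (carried_over ft) in
  sprod w w = face (isT : (0 < 1 <= 1)%N) w :> E 2 A.
Proof. by apply: hom_set_ext; exact: carried_assoc ft.1. Qed.

(** An element of E^0(A) restricts to the identity over k. *)
Lemma hom0_iso A (g : E 0 A) : arr_iso (sval g).
Proof.
case: g => a /over_beta0P[sa ta oa] /=; apply: arr_to_k_reflects_iso.
suff -> : redk A a = Arr (idm (B_ k)) by exists (idm _); rewrite comp1m.
by apply: (acomp_injl alpha_iso'); rewrite ?tgt_amap ?ta ?cmap_lim_at // oa acompa1.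
Qed.

Lemma hom0_inv A (g : E 0 A) : over_beta adj alpha 0 (ainv (sval g)).
Proof.
have ig := hom0_iso g; case: g ig => a /over_beta0P[sa ta oa] /= ig.
apply/over_beta0P; rewrite src_ainv // tgt_ainv //; split=> //.
have ik : arr_iso (redk A a) by exact: arr_iso_amap.
have tk : tgt (redk A a) = B_ k by rewrite tgt_amap ta cmap_lim_at.
have sk : src (redk A a) = B_ k by rewrite src_amap sa cmap_lim_at.
rewrite amap_ainv // -{1}oa -acompA ?tgt_ainv ?src_ainv //.
by rewrite (ainv_r ik tk) acompa1.
Qed.

(** The exhibited inverse in the definition of the gauge action always exists, so
    the action is an intertwining relation. *)
Lemma gaugeP A (w w' : E 1 A) (g : E 0 A) :
  gauge w w' g <-> sval g \oa sval w = sval w' \oa amap (T A) (sval g).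
Proof.
have [g' gE] := arrP (hom_src g) (hom_tgt g).
have [v vE] := arrP (hom_src w) (hom_tgt w).
have [v' vE'] := arrP (hom_src w') (hom_tgt w').
split=> [[h [gh hg]] /(congr1 sval) /=|e].
  have [h' hE] := arrP (hom_src h) (hom_tgt h).
  move: gh hg => /(congr1 sval) /= gh /(congr1 sval) /= hg.
  move: gh hg; rewrite gE vE vE' hE !acompE => /Arr_inj gh /Arr_inj hg.
  move=> /Arr_inj <-; congr Arr.
  by rewrite -[RHS]compA -(fmor_comp (T A)) hg fmor_id compm1.
exists (exist _ _ (hom0_inv g)); have ig := hom0_iso g.
split; apply: hom_set_ext => /=.
- by rewrite (ainv_r ig (hom_tgt g)).
- by rewrite (ainv_l ig (hom_src g)).
rewrite e -acompA; last 2 first.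
- by rewrite !tgt_amap tgt_ainv // hom_src.
- by rewrite tgt_amap hom_tgt hom_src.
rewrite -amap_acomp ?tgt_ainv // (ainv_r ig (hom_tgt g)) amap_idm acompa1 //.
exact: hom_src.
Qed.

(** * The equivalence between deformations and Maurer-Cartan elements *)

Variable E_sdc : is_sdc E.
Local Notation MCcat := (Def_sdc E_sdc).

Lemma mc_groupoid A : is_groupoid (MCcat A).
Proof.
move=> x y f; have ig := hom0_iso (sval f).
have [g [gi [gE giE e e']]] := arr_isoE ig (hom_src (sval f)) (hom_tgt (sval f)).
have h : gauge (sval y) (sval x) (exist _ _ (hom0_inv (sval f))).
  apply/gaugeP; have := (gaugeP _ _ _).1 (svalP f); rewrite /= giE gE.
  have [v ->] := arrP (hom_src (sval x)) (hom_tgt (sval x)).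
  have [w ->] := arrP (hom_src (sval y)) (hom_tgt (sval y)).
  rewrite !amap_Arr !acompE => /Arr_inj gv; congr Arr.
  rewrite -[w]compm1 -(fmor_id (T A)) -e' fmor_comp (compA w) -gv.
  by rewrite -!compA (compA gi) e comp1m.
exists (exist _ _ h); split; apply: mc_hom_ext; apply: hom_set_ext => /=.
  by rewrite (ainv_l ig (hom_src _)).
by rewrite (ainv_r ig (hom_tgt _)).
Qed.

Lemma def_groupoid A : is_groupoid (Def D0 A).
Proof.
move=> x y [f fE].
have fk : arr_iso (amap (cmap D (to_k A)) (Arr f)).
  apply: (arr_iso_cancel _ (dphi_iso y)); first by rewrite dphi_src.
  by rewrite fE; exact: dphi_iso.
have [g [gf fg]] : is_iso f.
  apply: (monadic_reflects_iso (adj_monadic A)).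
  apply: (arr_to_k_reflects_iso (a := amap (U A) (Arr f))).
  by rewrite -ctrans_nat; exact: arr_iso_amap.
have gE : dphi x \oa amap (cmap D (to_k A)) (Arr g) = dphi y.
  rewrite -fE -acompA ?tgt_amap ?dphi_src // -amap_acomp // acompE fg amap_idm acompa1 //.
  by rewrite dphi_src.
exists (exist _ g gE); split; exact: def_hom_ext.
Qed.

Definition chosen A (X : def_ob D0 A) : arr (B A) := sval (cid (framing_exists X)).

Lemma chosenP A (X : def_ob D0 A) : framing X (chosen X).
Proof. exact: svalP. Qed.

Definition mc_of A (X : def_ob D0 A) t (ft : framing X t) : MCcat A :=
  exist _ (exist _ _ (carried_over ft)) (carried_mc ft).

(** The source and target are only required to be the carried structures up to
    equality of arrows, so that this covers both a morphism of deformations and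
    a change of framing after base change. *)
Lemma gauge_transport A (X Y : def_ob D0 A) (f : def_hom X Y) t s
    (ft : framing X t) (fs : framing Y s) (w w' : E 1 A) :
  sval w = carried_action (dob X) t -> sval w' = carried_action (dob Y) s ->
  gauge w w' (exist _ _ (transport_over f ft fs)).
Proof.
move=> e e'; apply/gaugeP; rewrite e e'.
by apply: transport_carried; [exact: ft.1|exact: fs.1].
Qed.

Definition mc_transport A (X Y : def_ob D0 A) (f : def_hom X Y) t s
    (ft : framing X t) (fs : framing Y s) (w w' : MCcat A)
    (wE : sval (sval w) = carried_action (dob X) t)
    (wE' : sval (sval w') = carried_action (dob Y) s) : hom w w' :=
  exist _ _ (gauge_transport f ft fs wE wE').

Definition compare_mor A (X Y : def_ob D0 A) (f : def_hom X Y) :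
    hom (mc_of (chosenP X)) (mc_of (chosenP Y)) :=
  @mc_transport A X Y f _ _ (chosenP X) (chosenP Y)
    (mc_of (chosenP X)) (mc_of (chosenP Y)) erefl erefl.

Lemma compare_id A (X : Def D0 A) : compare_mor (idm X) = idm (mc_of (chosenP X)).
Proof. by apply: mc_hom_ext; apply: hom_set_ext; exact: transport_id (chosenP X).1. Qed.

Lemma compare_comp A (X Y Z : Def D0 A) (g : hom Y Z) (f : hom X Y) :
  compare_mor (g \oc f) = compare_mor g \oc compare_mor f.
Proof.
apply: mc_hom_ext; apply: hom_set_ext; apply/esym.
exact: transport_comp (chosenP X).1 (chosenP Y).1 (chosenP Z).1.
Qed.

Definition compare A : functor (Def D0 A) (MCcat A) :=
  @Functor (Def D0 A) (MCcat A) (fun X => mc_of (chosenP X)) (@compare_mor A)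
    (@compare_id A) (@compare_comp A).

Section Transition.
Variables (A A' : CL) (r : chom A A').

(** The chosen framing of X, pushed forward along r, and the chosen framing of the
    push-forward of X differ by a gauge transformation: the identity of X seen in
    these two framings. *)
Definition transition (X : Def D0 A) :
    hom (cmap MCcat r (compare A X)) (compare A' (cmap (Def D0) r X)) :=
  @mc_transport A' _ _ (def_id (def_map_ob r X)) _ _
    (framing_map r (chosenP X)) (chosenP (def_map_ob r X))
    (cmap MCcat r (compare A X)) (compare A' (def_map_ob r X))
    (carried_map r (chosenP X).1) erefl.

Lemma transition_nat (X Y : Def D0 A) (f : hom X Y) :
  transition Y \oc fmor (cmap MCcat r) (fmor (compare A) f)
  = fmor (compare A') (fmor (cmap (Def D0) r) f) \oc transition X.
Proof.
apply: mc_hom_ext; apply: hom_set_ext => /=.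
rewrite (transport_map _ _ (chosenP X).1 (chosenP Y).1) amap_Arr.
have [fx fy] := ((framing_map r (chosenP X)).1, (framing_map r (chosenP Y)).1).
rewrite (transport_comp _ _ fx fy (chosenP (def_map_ob r Y)).1).
rewrite (transport_comp _ _ fx (chosenP (def_map_ob r X)).1 (chosenP (def_map_ob r Y)).1).
by rewrite comp1m compm1.
Qed.
End Transition.

Lemma cmap_id_ob (Y : cat_functor L) A (x : Y A) : cmap Y (chom_id A) x = x.
Proof. exact: (congr1 (@src _) (cmap_id (Arr (idm x)))). Qed.

Lemma transition_id A (X : Def D0 A) :
  Arr (transition (chom_id A) X) = Arr (idm (compare A X)).
Proof.
have eX : def_map_ob (chom_id A) X = X := cmap_id_ob (Y := Def D0) X.
apply: mc_arr_ext => /=.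
- by apply: hom_set_ext; rewrite /= cmap_id.
- exact: (congr1 (fun Z : Def D0 A => sval (mc_of (chosenP Z))) eX).
- apply: hom_set_ext => /=; rewrite cmap_id.
  have := congr1 (fun Z : def_ob D0 A =>
    transport (Arr (idm (dob Z))) (chosen X) (chosen Z)) eX.
  by move=> /= ->; exact: transport_id (chosenP X).1.
Qed.

Lemma transition_comp A A' A'' (r' : chom A' A'') (r : chom A A') (X : Def D0 A) :
  Arr (transition (chom_comp r' r) X)
  = Arr (transition r' (cmap (Def D0) r X)) \oa amap (cmap MCcat r') (Arr (transition r X)).
Proof.
have eX : def_map_ob (chom_comp r' r) X = def_map_ob r' (def_map_ob r X) :=
  cmap_comp_ob (X := Def D0) r' r X.
rewrite amap_Arr acompE; apply: mc_arr_ext => /=.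
- by apply: hom_set_ext; rewrite /= cmap_comp.
- exact: (congr1 (fun Z : Def D0 A'' => sval (mc_of (chosenP Z))) eX).
- apply: hom_set_ext => /=; rewrite cmap_comp.
  have f1 := (framing_map r (chosenP X)).1; have f2 := (chosenP (def_map_ob r X)).1.
  have f3 := (framing_map r' (framing_map r (chosenP X))).1.
  have f4 := (framing_map r' (chosenP (def_map_ob r X))).1.
  have f5 := (chosenP (def_map_ob r' (def_map_ob r X))).1.
  rewrite (transport_map _ _ f1 f2) amap_idm (transport_comp _ _ f3 f4 f5) comp1m.
  exact: (congr1 (fun Z : def_ob D0 A'' => transport (Arr (idm (dob Z))) _ (chosen Z)) eX).
Qed.

Lemma transition_iso A A' (r : chom A A') (X : Def D0 A) : is_iso (transition r X).
Proof. exact: mc_groupoid. Qed.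

Definition compare_trans : pseudo_trans (Def D0) MCcat :=
  PseudoTrans transition_iso transition_nat transition_id transition_comp.

Lemma compare_faithful A : faithful (compare A).
Proof.
move=> X Y f g fg.
have /= e := congr1 (fun h : mc_hom (mc_of (chosenP X)) (mc_of (chosenP Y)) =>
  sval (sval h : hom_set adj alpha 0 A)) fg.
apply: def_hom_ext; apply: (monadic_faithful (adj_monadic A)).
have [t [ti [tE tiE tit _]]] := framedE (chosenP X).1.
have [s [si [sE siE sis _]]] := framedE (chosenP Y).1.
rewrite tE in tiE; move: e; rewrite tE sE !(transportE _ _ tiE).
move=> /Arr_inj /(congr1 (fun h => si \oc h \oc t)).
by rewrite !compA sis !comp1m -!compA tit !compm1.
Qed.

(** A gauge transformation, read in the chosen framings, is an algebra morphism
    UX -> UY, hence comes from D; it lies over the identity of D0 because elements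
    of E^0 restrict to the identity over k and U is faithful. *)
Lemma compare_full A : full (compare A).
Proof.
move=> X Y [[g og] gg].
have [t [ti [tE tiE tit tti]]] := framedE (chosenP X).1.
have [s [si [sE siE sis ssi]]] := framedE (chosenP Y).1.
have /= ge := (gaugeP _ _ _).1 gg.
have [sg tg ok] := (over_beta0P _).1 og.
have [g' gE] := arrP sg tg.
rewrite tE in tiE; rewrite sE in siE.
rewrite tE sE (carriedE tiE) (carriedE siE) gE amap_Arr !acompE in ge.
move/Arr_inj: ge => ge.
pose h := si \oc (g' \oc t).
have [|f fE] := monadic_full (adj_monadic A) (h := h).
  rewrite /h.
  have := congr1 (fun v => si \oc v \oc fmor (T A) t) ge.
  rewrite -!compA -(fmor_comp (T A) ti) tit fmor_id compm1 => ->.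
  by rewrite !compA sis comp1m -!compA -!(fmor_comp (T A)).
have gfE : transport (Arr f) (chosen X) (chosen Y) = Arr g'.
  rewrite tE sE (transportE _ _ tiE) fE /h; congr Arr.
  by rewrite !compA ssi comp1m -compA tti compm1.
have over : dphi Y \oa amap (cmap D (to_k A)) (Arr f) = dphi X.
  apply: (amap_monadic_inj (adj_monadic k)).
  - by rewrite src_acomp ?tgt_amap ?dphi_src.
  - by rewrite tgt_acomp ?tgt_amap ?dphi_src // !dphi_tgt.
  rewrite amap_acomp ?tgt_amap ?dphi_src // -(chosenP Y).2 -(chosenP X).2 ctrans_nat.
  rewrite gE in ok; rewrite -[in RHS]ok -!acompA ?tgt_amap ?tE ?sE ?cmap_lim_at //.
  rewrite -!amap_acomp // amap_Arr !acompE fE /h.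
    by rewrite (compA s) ssi comp1m.
  by rewrite src_amap /= cmap_lim_at.
exists (exist _ f over); apply: mc_hom_ext; apply: hom_set_ext => /=.
by rewrite gfE gE.
Qed.

Lemma mc_mult A (w : MC E A) (v : hom (T A (B_ A)) (B_ A)) : sval (sval w) = Arr v ->
  v \oc fmor (T A) v = v \oc mult (adj A) (B_ A).
Proof.
move=> vE; have /= := congr1 sval (svalP w).
by rewrite face_arrE /mult_at subnn vE /= amap_Arr !acompE => /Arr_inj.
Qed.

(** Put u = w o eta.  Naturality of eta and associativity give u o w = w, hence
    u o u = u, and an invertible idempotent is the identity. *)
Lemma mc_unit A (w : MC E A) :
  sval (sval w) \oa Arr (adj_unit (adj A) (B_ A)) = Arr (idm (B_ A)).
Proof.
have [v vE] := arrP (hom_src (sval w)) (hom_tgt (sval w)).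
have v2 := mc_mult vE.
pose u : E 0 A := hom_degen (isT : (0 < 1)%N) (sval w).
have uE : sval u = Arr (v \oc adj_unit (adj A) (B_ A)) by rewrite /= degen_arrE vE /= acompE.
have [u' [ui [u'E _ uiu _]]] := arr_isoE (hom0_iso u) (hom_src u) (hom_tgt u).
rewrite u'E in uE; move/Arr_inj: uE => /= uE.
rewrite vE acompE -uE; congr Arr.
have uv : u' \oc v = v.
  rewrite uE -compA (unit_nat (adj A)) compA v2 -compA.
  by rewrite (triangleU (adj A)) compm1.
have uu : u' \oc u' = u' by rewrite {2}uE compA uv -uE.
by rewrite -[u']comp1m -uiu -compA uu.
Qed.

(** An element w satisfying the Maurer-Cartan equation is an algebra structure on
    B(A), so it is isomorphic by some t to the algebra of an object x of D(A).
    Over k, alpha o t is a morphism between the algebras of x and of D0, which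
    provides the identification of x with D0; for it t is a framing. *)
Lemma mc_framing A (w : MC E A) :
  exists (X : def_ob D0 A) t, framing X t /\ carried_action (dob X) t = sval (sval w).
Proof.
have [v vE] := arrP (hom_src (sval w)) (hom_tgt (sval w)).
have v1 : v \oc adj_unit (adj A) (B_ A) = idm (B_ A).
  by have := mc_unit w; rewrite vE acompE => /Arr_inj.
have v2 := mc_mult vE.
have [x [t [it tv]]] := monadic_algebra (adj_monadic A) v1 v2.
have [_ _ ow] := svalP (sval w); rewrite vE /= in ow.
have tk : tgt (redk A (Arr t)) = B_ k by rewrite tgt_amap /= cmap_lim_at.
have [h hE] : exists h : hom (U k (cmap D (to_k A) x)) (U k D0),
    Arr alpha \oa redk A (Arr t) = Arr h.
  apply: arrP; last by rewrite tgt_acomp.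
  by rewrite src_acomp // src_amap /= ctrans_nat_ob.
have hi : is_iso h.
  rewrite -[is_iso h]/(arr_iso (Arr h)) -hE.
  exact/arr_iso_acomp/arr_iso_amap.
have [|p pE] := monadic_full (adj_monadic k) (h := h).
  apply: Arr_inj; rewrite -!acompE -hE.
  have -> : Arr (fmor (U k) (adj_counit (adj k) (cmap D (to_k A) x))) = redk A (Ueps A x).
    by rewrite -ctrans_nat counit_base.
  rewrite -acompA // -amap_acomp // amap_Arr acompE tv -acompE amap_acomp //.
  rewrite acompA; [|by []|by rewrite tgt_amap /= cmap_lim_at].
  have -> : redk A (Arr (fmor (T A) t)) = amap (T k) (redk A (Arr t)).
    exact: (top_base U F (to_k A) (Arr t)).
  have b1 : hom_beta adj D0 1 = Ueps k D0 by rewrite /hom_beta /= comp1m.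
  rewrite ow b1 -acompA //; last by rewrite tgt_amap tk.
  by rewrite -amap_acomp // hE.
have pi : is_iso p by apply: (monadic_reflects_iso (adj_monadic k)); rewrite pE.
pose X := @DefOb _ _ D0 A x (Arr p) erefl erefl pi.
exists X, (Arr t); split; last by rewrite vE; exact: carried_uniq.
by split; [split|rewrite hE /= amap_Arr pE].
Qed.

Lemma compare_ess_surj A : essentially_surjective (compare A).
Proof.
move=> w; have [X [t [ft wE]]] := mc_framing w; exists X.
exists (@mc_transport A X X (def_id X) _ _ (chosenP X) ft (mc_of (chosenP X)) w
  erefl (esym wE)).
exact: mc_groupoid.
Qed.

Lemma compare_equivalence : groupoid_functors_equivalent (Def D0) MCcat.
Proof.
split; [exact: def_groupoid|exact: mc_groupoid|exists compare_trans => A].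
by split; [exact: compare_full|exact: compare_faithful|exact: compare_ess_surj].
Qed.
End Framings.

(** * Equivalence of the two deformation groupoids *)

Theorem theorem3p3 (L : complete_noetherian_local_ring)
    (D B : cat_functor L) (U : cat_trans D B) (F : cat_trans B D)
    (adj : functorial_adjunction U F)
    (adj_monadic : forall A : artalg L, monadic (adj A))
    (B_triv : uniformly_trivial_deformation_theory B)
    (D0 : D (kobj L))
    (B0 : lim_ob B) (alpha : hom (lim_at B0 (kobj L)) (U (kobj L) D0))
    (alpha_iso : is_iso alpha) :
  exists E_sdc : is_sdc (hom_sdc_data adj alpha),
    groupoid_functors_equivalent (Def D0) (Def_sdc E_sdc).
Proof.
have [_ B_hom B_lift] := B_triv.
have B_full A A' (f : chom A A') : surjective f -> full (cmap B f) by move=> /B_lift[].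
exists (hom_is_sdc adj B_hom B_full alpha_iso).
exact: compare_equivalence.
Qed.
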